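(* Let $f_\theta:\mathbb{R}^{n_0}\to\mathbb{R}^{n_D}$ be any neural network with input dimension $n_0$, output dimension $n_D$, and $n_\theta$ parameters $\theta\in\mathbb{R}^{n_\theta}$, using piecewise analytic activation functions. Then, given any dataset $\{(x_i,y_i)\}_{i=1}^m\subset\mathbb{R}^{n_0}\times\mathbb{R}^{n_D}$ and any analytic loss function $l:\mathbb{R}^{n_D}\times\mathbb{R}^{n_D}\to\mathbb{R}$, the empirical loss $L:\mathbb{R}^{n_\theta}\to\mathbb{R}$, $$L(\theta)=\frac1m\sum_{i=1}^m l(y_i,f_\theta(x_i)),$$ is almost everywhere analytic.
   Context: Measure means Lebesgue measure. A function $f:\mathbb{R}\to\mathbb{R}$ is piecewise analytic if there is a strictly increasing sequence of reals $\{x_i\}_{i\in\mathbb{Z}}$ with $x_i\to\pm\infty$ as $i\to\pm\infty$ such that $f$ restricted to each open interval $(x_i,x_{i+1})$ is (real) analytic. A function $f:\mathbb{R}^p\to\mathbb{R}^q$ is analytic almost everywhere if there is an open set $U\subset\mathbb{R}^p$ whose complement has measure zero such that $f|_U$ is analytic. Neural networks. A neural network $f_\theta=f^{(D)}\circ\cdots\circ f^{(1)}$ is a composition of finitely many layers, and $\theta$ collects all the independent parameters of all layers, so that the parameter space is a Euclidean space $\mathbb{R}^{n_\theta}$. Bias terms are set to zero. Each layer is one of the following. (i) Fully connected layer: $z\mapsto\sigma_d(W_dz)$ with parameter $W_d\in\mathbb{R}^{n_d\times n_{d-1}}$ and activation function $\sigma_d:\mathbb{R}\to\mathbb{R}$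 applied entry-wise. (ii) Convolutional layer: as a fully connected layer, except that certain prescribed entries of $W_d$ are constrained to be equal to each other; the parameters are the independent entries. (iii) Softmax attention layer: with parameters $W_q,W_k,W_v$ (real matrices of the same shape), it takes a sequence $x_1,\dots,x_n$ of vectors of the same dimension, forms the matrix $X$ with columns $x_1,\dots,x_n$, sets $Q=W_qX$, $K=W_kX$, $V=W_vX$, and outputs the sequence of columns of $\mathrm{Attention}(Q,K,V)=\mathrm{softmax}\!\left(\frac{QK^T}{\sqrt n}\right)V$, where softmax is applied independently to every row. When layers of different types are stacked, a sequence of vectors is identified with the vector obtained by concatenation (and conversely). *)

(* Defs.v *)
(* The space R^p is the type 'rV[R]_p of row vectors. *)
From HB Require Import structures.
From mathcomp Require Export all_boot all_order all_algebra.
From mathcomp Require Export all_classical all_reals all_analysis.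
Export Order.TTheory GRing.Theory Num.Theory.
Export numFieldNormedType.Exports.

Set Implicit Arguments.
Unset Strict Implicit.
Unset Printing Implicit Defensive.

Local Open Scope classical_set_scope.
Local Open Scope ring_scope.

Section Analytic.
Context {R : realType}.

(* Multi-indices are the finite functions {ffun 'I_p -> nat}. *)
Definition monomial p (h : 'rV[R]_p) (a : {ffun 'I_p -> nat}) : R :=
  \prod_(i < p) h 0 i ^+ a i.

(* The family u is summed along the exhaustion of the multi-indices by the
   boxes {0, ..., N-1}^p; the order is irrelevant as summability (that is,
   absolute convergence) is also required. *)
Definition multi_sum p (u : {ffun 'I_p -> nat} -> R) (s : R) : Prop :=
  summable [set: {ffun 'I_p -> nat}] (fun a => (u a)%:E) /\
  (fun N : nat => \sum_(a : {ffun 'I_p -> 'I_N}) u [ffun i => val (a i)])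
    @ \oo --> s.

(* f is the sum of a power series on a polydisc centred at x. *)
Definition analytic_at p (f : 'rV[R]_p -> R) (x : 'rV[R]_p) : Prop :=
  exists (r : R) (c : {ffun 'I_p -> nat} -> R), 0 < r /\
    forall h : 'rV[R]_p, (forall i, `|h 0 i| < r) ->
      multi_sum (fun a => c a * monomial h a) (f (x + h)).

(* Meant for an open U, where this is the analyticity of the restriction. *)
Definition analytic_on p (U : set 'rV[R]_p) (f : 'rV[R]_p -> R) : Prop :=
  forall x, U x -> analytic_at f x.

(* Functions of one real variable are viewed as functions on 'rV[R]_1. *)
Definition analytic_itv (a b : R) (f : R -> R) : Prop :=
  analytic_on [set v : 'rV[R]_1 | a < v 0 0 < b] (fun v => f (v 0 0)).

Definition piecewise_analytic (f : R -> R) : Prop :=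
  exists x : int -> R,
    [/\ forall i j : int, i < j -> x i < x j,
        (fun n : nat => x n%:Z) @ \oo --> +oo,
        (fun n : nat => x (- n%:Z)) @ \oo --> -oo &
        forall i : int, analytic_itv (x i) (x (i + 1)) f].

Definition box p (a b : 'rV[R]_p) : set 'rV[R]_p :=
  [set x : 'rV[R]_p | forall i, a 0 i <= x 0 i <= b 0 i].

(* Lebesgue outer measure.  Covers are indexed by a subset D of nat, since in
   dimension 0 there is no box of volume 0. *)
Definition lebesgue_outer p (A : set 'rV[R]_p) : \bar R :=
  ereal_inf [set v : \bar R |
    exists (D : set nat) (a b : nat -> 'rV[R]_p),
      [/\ forall k i, a k 0 i <= b k 0 i,
          A `<=` \bigcup_(k in D) box (a k) (b k) &
          v = \esum_(k in D) (\prod_(i < p) (b k 0 i - a k 0 i))%:E]].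

(* As Lebesgue measure is complete, these are exactly the sets of measure 0. *)
Definition measure_zero p (A : set 'rV[R]_p) : Prop :=
  lebesgue_outer A = 0%E.

Definition ae_analytic p (f : 'rV[R]_p -> R) : Prop :=
  exists U : set 'rV[R]_p,
    [/\ open U, measure_zero (~` U) & analytic_on U f].

End Analytic.

Section Networks.
Context {R : realType}.

(* - [Convolutional tie _ sigma] has weight matrix W i j = w (tie i j), where w
     is the vector of the k independent entries; surjectivity says that each of
     them occurs in W.
   - [Attention n d h] acts on n vectors of R^d and returns n vectors of R^h.
     The equalities let layers be stacked whenever the total dimensions agree. *)
Inductive layer (nin nout : nat) : Type :=
| FullyConnected (sigma : R -> R)
| Convolutional (k : nat) (tie : 'I_nout -> 'I_nin -> 'I_k)
    (tie_surj : forall c, exists i j, tie i j = c) (sigma : R -> R)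
| Attention (n d h : nat) (n_gt0 : (0 < n)%N)
    (eq_in : nin = (n * d)%N) (eq_out : nout = (n * h)%N).

Inductive network (n0 : nat) : nat -> Type :=
| OneLayer n1 of layer n0 n1 : network n0 n1
| Stack n1 n2 of network n0 n1 & layer n1 n2 : network n0 n2.

Definition layer_nparams nin nout (l : layer nin nout) : nat :=
  match l with
  | FullyConnected _ => (nout * nin)%N
  | @Convolutional _ _ k _ _ _ => k
  | @Attention _ _ n d h _ _ _ => (h * d + (h * d + h * d))%N
  end.

Fixpoint nparams n0 nD (N : network n0 nD) : nat :=
  match N with
  | OneLayer _ l => layer_nparams l
  | Stack _ _ N' l => (nparams N' + layer_nparams l)%N
  end.

Definition dense nin nout (sigma : R -> R) (W : 'M[R]_(nout, nin))
    (z : 'rV[R]_nin) : 'rV[R]_nout :=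
  map_mx sigma (W *m z^T)^T.

Definition softmax_rows p q (A : 'M[R]_(p, q)) : 'M[R]_(p, q) :=
  \matrix_(i, j) (expR (A i j) / \sum_(k < q) expR (A i k)).

(* The columns of X are the input vectors and those of the result the output
   vectors. *)
Definition attention n d h (Wq Wk Wv : 'M[R]_(h, d)) (X : 'M[R]_(d, n)) :
    'M[R]_(h, n) :=
  let Q := Wq *m X in let K := Wk *m X in let V := Wv *m X in
  softmax_rows ((Num.sqrt n%:R)^-1 *: (Q *m K^T)) *m V.

(* [mxvec] and [vec_mx] are row-major: transposing makes the concatenation of
   vectors correspond to the matrix having them as columns. *)
Definition attention_vec n d h (w : 'rV[R]_(h * d + (h * d + h * d)))
    (z : 'rV[R]_(n * d)) : 'rV[R]_(n * h) :=
  mxvec (attention (vec_mx (lsubmx w)) (vec_mx (lsubmx (rsubmx w)))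
                   (vec_mx (rsubmx (rsubmx w))) (vec_mx z)^T)^T.

Definition layer_eval nin nout (l : layer nin nout) :
    'rV[R]_(layer_nparams l) -> 'rV[R]_nin -> 'rV[R]_nout :=
  match l return 'rV[R]_(layer_nparams l) -> 'rV[R]_nin -> 'rV[R]_nout with
  | FullyConnected sigma => fun w z => dense sigma (vec_mx w) z
  | @Convolutional _ _ k tie _ sigma => fun w z =>
      dense sigma (\matrix_(i < nout, j < nin) w 0 (tie i j)) z
  | @Attention _ _ n d h _ eq_in eq_out => fun w z =>
      castmx (erefl 1%N, esym eq_out)
        (attention_vec w (castmx (erefl 1%N, eq_in) z))
  end.

Fixpoint net_eval n0 nD (N : network n0 nD) :
    'rV[R]_(nparams N) -> 'rV[R]_n0 -> 'rV[R]_nD :=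
  match N in network _ nD
    return 'rV[R]_(nparams N) -> 'rV[R]_n0 -> 'rV[R]_nD with
  | OneLayer _ l => fun theta x => layer_eval theta x
  | Stack _ _ N' l => fun theta x =>
      layer_eval (rsubmx theta) (net_eval (lsubmx theta) x)
  end.

Definition layer_piecewise_analytic nin nout (l : layer nin nout) : Prop :=
  match l with
  | FullyConnected sigma => piecewise_analytic sigma
  | Convolutional _ _ _ sigma => piecewise_analytic sigma
  | Attention _ _ _ _ _ _ => True
  end.

Fixpoint net_piecewise_analytic n0 nD (N : network n0 nD) : Prop :=
  match N with
  | OneLayer _ l => layer_piecewise_analytic l
  | Stack _ _ N' l =>
      net_piecewise_analytic N' /\ layer_piecewise_analytic l
  end.

Definition analytic_loss q (l : 'rV[R]_q -> 'rV[R]_q -> R) : Prop :=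
  analytic_on [set: 'rV[R]_(q + q)] (fun v => l (lsubmx v) (rsubmx v)).

Definition empirical_loss n0 nD (N : network n0 nD) m
    (x : 'I_m -> 'rV[R]_n0) (y : 'I_m -> 'rV[R]_nD)
    (l : 'rV[R]_nD -> 'rV[R]_nD -> R) (theta : 'rV[R]_(nparams N)) : R :=
  m%:R^-1 * \sum_(i < m) l (y i) (net_eval theta (x i)).

End Networks.

(* Main.v *)
Require Import Defs.
From mathcomp Require Import ring lra zify.

(** Sums, products, exponentials, inverses of nonzero quantities and, more
    generally, compositions of analytic functions are analytic. The only obstacle to the
    analyticity of the loss is therefore the breakpoints of the activation functions,
    and what has to be shown is that almost everywhere analytic functions are stable
    under composition with a piecewise analytic [sigma] ([ae_analytic_piecewise]). Let
    [f] be analytic on a conull open set [U]. At a point of [U] where [f] is not a breakpoint,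
    or where it is constant nearby, [sigma \o f] is analytic. The other points lie in
    level sets of [f] at which [f] is not locally constant, and these are null because
    the zero set of a nonzero power series is null. Countably many breakpoints
    contribute countably many null sets.

    The nullity of zero sets ([zero_set_measure_zero]) comes from the implicit function
    theorem in its weakest form. Some iterated derivative of [f] does not vanish at the
    centre of the expansion, hence not on a small cube around it. Going from [f] to that
    derivative one differentiation at a time, one meets at each zero of [f] in the cube
    a function [g] which vanishes there while its next derivative does not, and near
    such a point the zeros of [g] lie in a Lipschitz graph ([measure_zero_transversal]).
    Such a graph is null, as a fine grid shows ([measure_zero_graph]), and local nullity
    is global by Lindelof's argument ([measure_zero_local]). Formally this is an induction
    on the degree of a nonzero coefficient, in which all the series keep the same centre.

    Composition of analytic functions in several variables rests on the Banach algebra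
    of power series with the weighted l1 norm of the coefficients: its completeness
    ([expands_asum]) gives products and substitution ([expands_psum]), and shrinking
    the cube makes the norm of a series without constant term small ([expands_small]).

    In a network, every layer is built from these operations on its parameters and
    inputs ([layer_ae_analytic]), and one concludes by induction on the layers, all
    functions being considered on the full parameter space. *)

Set Implicit Arguments.
Unset Strict Implicit.
Unset Printing Implicit Defensive.

Local Open Scope classical_set_scope.
Local Open Scope ring_scope.

(** * Unconditional sums of real families *)

Section UnconditionalSums.
Context {R : realType}.

Definition nsum (I : choiceType) (u : I -> R) : \bar R :=
  \esum_(i in [set: I]) (u i)%:E.

(** The unordered sum of a real family, as the difference of the sums of its
    positive and negative parts: every statement about it reduces to the theory of
    sums of nonnegative families. *)
Definition asum (I : choiceType) (t : I -> R) : R :=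
  fine (\esum_(i in [set: I]) (EFin \o t)^\+%E i -
        \esum_(i in [set: I]) (EFin \o t)^\-%E i)%E.

Definition abs_summable (I : choiceType) (t : I -> R) : Prop :=
  (nsum (fun i => `|t i|%R) < +oo)%E.

Section OneIndex.
Context {I : choiceType}.
Implicit Types t u v : I -> R.

Lemma nsum_ge0 u : (forall i, 0 <= u i) -> (0 <= nsum u)%E.
Proof. by move=> u0; apply: esum_ge0 => i _; rewrite lee_fin. Qed.

Lemma le_nsum u v : (forall i, u i <= v i) -> (nsum u <= nsum v)%E.
Proof. by move=> uv; apply: le_esum => i _; rewrite lee_fin. Qed.

Lemma nsum_fin_num u : (forall i, 0 <= u i) -> (nsum u < +oo)%E ->
  nsum u \is a fin_num.
Proof. by move=> u0 ufin; rewrite ge0_fin_numE// nsum_ge0. Qed.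

Lemma nsumD u v : (forall i, 0 <= u i) -> (forall i, 0 <= v i) ->
  nsum (fun i => u i + v i) = (nsum u + nsum v)%E.
Proof. by move=> u0 v0; rewrite /nsum -esumD// => i _; rewrite lee_fin. Qed.

(** One inequality holds because scaling commutes with finite sums; the other
    one is the first one applied to the inverse factor. *)
Lemma nsumZ (k : R) u : 0 <= k -> (forall i, 0 <= u i) ->
  nsum (fun i => k * u i) = (k%:E * nsum u)%E.
Proof.
have le_scale (c : R) (w : I -> R) : 0 <= c -> (forall i, 0 <= w i) ->
    (nsum (fun i => c * w i)%R <= c%:E * nsum w)%E.
  move=> c0 w0; rewrite /nsum; apply: ge_ereal_sup => _ [X [finX XI]] <-.
  have -> : (\sum_(x \in X) (c * w x)%:E = c%:E * \sum_(x \in X) (w x)%:E)%E.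
    by rewrite ge0_mule_fsumr// => i; rewrite lee_fin.
  apply: lee_wpmul2l; first by rewrite lee_fin.
  by apply: esum_ge; exists X.
rewrite le_eqVlt => /predU1P[<- u0|k0 u0].
  rewrite mul0e /nsum esum1// => i _; by rewrite mul0r.
apply/eqP; rewrite eq_le le_scale ?(ltW k0)//=.
have ku0 i : 0 <= k * u i by rewrite mulr_ge0// ltW.
have := le_scale k^-1 _ (ltW (_ : 0 < k^-1)) ku0.
rewrite invr_gt0 => /(_ k0).
rewrite (_ : (fun i => _) = u); last first.
  by apply/funext => i; rewrite mulKf// gt_eqF.
move=> /(lee_wpmul2l (_ : 0 <= k%:E)%E); rewrite lee_fin => /(_ (ltW k0)).
by rewrite muleA -EFinM divff ?gt_eqF// mul1e.
Qed.

Lemma abs_summable_le t u : (forall i, `|t i| <= u i) -> (nsum u < +oo)%E ->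
  abs_summable t.
Proof. by move=> tu; apply: le_lt_trans; exact: le_nsum. Qed.

Lemma abs_summableD u v : abs_summable u -> abs_summable v ->
  abs_summable (fun i => u i + v i).
Proof.
move=> su sv; apply: (@abs_summable_le _ (fun i => `|u i| + `|v i|)).
  by move=> i; exact: ler_normD.
by rewrite nsumD//; exact: lte_add_pinfty.
Qed.

Lemma abs_summableZ (k : R) u : abs_summable u ->
  abs_summable (fun i => k * u i).
Proof.
move=> su; apply: (@abs_summable_le _ (fun i => `|k| * `|u i|)).
  by move=> i; rewrite normrM.
rewrite nsumZ// -(fineK (nsum_fin_num _ su))//; exact: ltry.
Qed.

(** The value of a sum can be read off any decomposition into two nonnegative
    summable families, not only the canonical one. Linearity and the exchange of
    sums follow from this freedom. *)
Lemma asum_sub u v : (forall i, 0 <= u i) -> (forall i, 0 <= v i) ->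
  (nsum u < +oo)%E -> (nsum v < +oo)%E ->
  asum (fun i => u i - v i) = fine (nsum u) - fine (nsum v).
Proof.
move=> u0 v0 ufin vfin.
have summ w : (forall i, 0 <= w i) -> (nsum w < +oo)%E ->
    summable [set: I] (fun i => (w i)%:E).
  by move=> w0; rewrite /summable/= (_ : (fun i => _) = EFin \o w)//;
     apply/funext => i/=; rewrite ger0_norm.
have := esumB (summ _ u0 ufin) (summ _ v0 vfin) (fun i _ => u0 i) (fun i _ => v0 i).
rewrite /asum => ->; rewrite fineD ?fineN ?fin_numN//; exact: nsum_fin_num.
Qed.


(** The positive part written polynomially in the absolute value, so that
    identities between parts are linear and [lra] decides them. *)
Definition ppart t i : R := (`|t i| + t i) / 2.
Definition npart t i : R := (`|t i| - t i) / 2.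

Lemma ppart_ge0 t i : 0 <= ppart t i.
Proof. by rewrite /ppart; have := ler_norm (- t i); rewrite normrN; lra. Qed.

Lemma npart_ge0 t i : 0 <= npart t i.
Proof. by rewrite /npart; have := ler_norm (t i); lra. Qed.

Lemma ppart_le t i : ppart t i <= `|t i|.
Proof. by rewrite /ppart; have := ler_norm (t i); lra. Qed.

Lemma npart_le t i : npart t i <= `|t i|.
Proof. by rewrite /npart; have := ler_norm (- t i); rewrite normrN; lra. Qed.

Lemma ppart_fin t : abs_summable t -> (nsum (ppart t) < +oo)%E.
Proof. by apply: le_lt_trans; apply: le_nsum => i; exact: ppart_le. Qed.

Lemma npart_fin t : abs_summable t -> (nsum (npart t) < +oo)%E.
Proof. by apply: le_lt_trans; apply: le_nsum => i; exact: npart_le. Qed.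

Lemma asumE t : abs_summable t ->
  asum t = fine (nsum (ppart t)) - fine (nsum (npart t)).
Proof.
move=> st; rewrite -asum_sub ?ppart_fin ?npart_fin//; last 2 first.
- exact: ppart_ge0.
- exact: npart_ge0.
by congr asum; apply/funext => i; rewrite /ppart /npart; lra.
Qed.

Lemma asumD t t' : abs_summable t -> abs_summable t' ->
  asum (fun i => t i + t' i) = asum t + asum t'.
Proof.
move=> st st'.
have E i : t i + t' i = (ppart t i + ppart t' i) - (npart t i + npart t' i).
  by rewrite /ppart /npart; lra.
under [X in asum X]eq_fun do rewrite E.
have p0 := ppart_ge0; have n0 := npart_ge0.
rewrite (asumE st) (asumE st') asum_sub ?nsumD//;
  try by move=> *; rewrite addr_ge0.
- rewrite !fineD ?nsum_fin_num ?ppart_fin ?npart_fin//; lra.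
- by apply: lte_add_pinfty; exact: ppart_fin.
- by apply: lte_add_pinfty; exact: npart_fin.
Qed.

Lemma asumZ (k : R) t : abs_summable t -> asum (fun i => k * t i) = k * asum t.
Proof.
move=> st; have p0 := ppart_ge0 t; have n0 := npart_ge0 t.
have pf := nsum_fin_num p0 (ppart_fin st).
have nf := nsum_fin_num n0 (npart_fin st).
have fin c : (c%:E * nsum (ppart t) < +oo)%E /\ (c%:E * nsum (npart t) < +oo)%E.
  by rewrite -(fineK pf) -(fineK nf) !ltry.
rewrite (asumE st); have [k0|k0] := leP 0 k.
- rewrite (_ : (fun i => _) = (fun i => k * ppart t i - k * npart t i)).
    have [? ?] := fin k.
    rewrite asum_sub ?nsumZ// => [|i|i]; try by rewrite mulr_ge0.
    by rewrite !fineM//= mulrBr.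
  by apply/funext => i; rewrite /ppart /npart; lra.
- have k0' : 0 <= - k by rewrite oppr_ge0 ltW.
  rewrite (_ : (fun i => _) = (fun i => (- k) * npart t i - (- k) * ppart t i)).
    have [? ?] := fin (- k).
    rewrite asum_sub ?nsumZ// => [|i|i]; try by rewrite mulr_ge0.
    by rewrite !fineM//=; lra.
  by apply/funext => i; rewrite /ppart /npart; lra.
Qed.

Lemma asumB t t' : abs_summable t -> abs_summable t' ->
  asum (fun i => t i - t' i) = asum t - asum t'.
Proof.
move=> st st'; rewrite -(mulN1r (asum t')) -asumZ// -asumD//.
- by congr asum; apply/funext => i; rewrite mulN1r.
- exact: abs_summableZ.
Qed.

Lemma asum_norm t : abs_summable t -> (`|asum t|%:E <= nsum (fun i => `|t i|%R))%E.
Proof.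
move=> st; rewrite (_ : (fun i => `|t i|) = (fun i => ppart t i + npart t i)).
  have p0 := ppart_ge0 t; have n0 := npart_ge0 t.
  rewrite asumE// nsumD// -{2}(fineK (nsum_fin_num p0 (ppart_fin st))).
  rewrite -{2}(fineK (nsum_fin_num n0 (npart_fin st))) -EFinD lee_fin.
  by rewrite (le_trans (ler_normB _ _))// !ger0_norm// fine_ge0// nsum_ge0.
by apply/funext => i; rewrite /ppart /npart; lra.
Qed.

Lemma asum_norm_le t (M : R) : (nsum (fun i => `|t i|%R) <= M%:E)%E ->
  `|asum t| <= M.
Proof.
move=> tM; rewrite -lee_fin (le_trans _ tM)//; apply: asum_norm.
by apply: le_lt_trans tM _; rewrite ltry.
Qed.

End OneIndex.

Lemma nsum_inj (I J : choiceType) (e : J -> I) (u : I -> R) :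
  injective e -> (forall i, (forall j, e j <> i) -> u i = 0) ->
  nsum u = nsum (u \o e).
Proof.
move=> einj u0; rewrite /nsum -(@esum_image _ _ _ setT e (fun i => (u i)%:E)).
  rewrite [RHS]esum_mkcond; apply: eq_esum => i _; case: ifPn => //.
  rewrite notin_setE => /= ni; rewrite u0// => j eji; apply: ni.
  by exists j.
by move=> x y _ _; exact: einj.
Qed.

Lemma nsum_comp_inj (I J : choiceType) (e : J -> I) (u : I -> R) :
  injective e -> (forall i, 0 <= u i) -> (nsum (u \o e) <= nsum u)%E.
Proof.
move=> einj u0; rewrite /nsum -(@esum_image _ _ _ setT e (fun i => (u i)%:E)).
  rewrite esum_mkcond; apply: le_esum => i _.
  by case: ifP => _; rewrite lee_fin.
by move=> x y _ _; exact: einj.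
Qed.

Lemma asum_inj (I J : choiceType) (e : J -> I) (t : I -> R) :
  injective e -> (forall i, (forall j, e j <> i) -> t i = 0) ->
  abs_summable t -> asum t = asum (t \o e).
Proof.
move=> einj t0 st.
have st' : abs_summable (t \o e).
  move: st; rewrite /abs_summable (nsum_inj einj)// => i ni.
  by rewrite t0// normr0.
rewrite !asumE// (nsum_inj einj); last first.
  by move=> i ni; rewrite /ppart t0// normr0 addr0 mul0r.
rewrite (nsum_inj (u := npart t) einj)// => i ni.
by rewrite /npart t0// normr0 subr0 mul0r.
Qed.

Lemma asum_single (I : choiceType) (i : I) (t : I -> R) :
  (forall j, j != i -> t j = 0) ->
  nsum (fun j => `|t j|) = `|t i|%:E /\ asum t = t i.
Proof.
move=> t0.
have single (u : I -> R) : (forall j, 0 <= u j) -> (forall j, j != i -> u j = 0) ->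
    nsum u = (u i)%:E.
  move=> u0 uz; rewrite /nsum -(@esum_set1 _ _ i (fun i => (u i)%:E)) ?lee_fin//.
  rewrite [RHS]esum_mkcond; apply: eq_esum => j _.
  case: ifPn => //; rewrite notin_setE/= => /eqP ji; by rewrite uz.
have tn : nsum (fun j => `|t j|) = `|t i|%:E.
  by apply: single => // j ji; rewrite t0// normr0.
split=> //; rewrite asumE; last by rewrite /abs_summable tn ltry.
rewrite !single/= ?/ppart ?/npart.
- lra.
- exact: npart_ge0.
- by move=> j ji; rewrite t0// normr0; lra.
- exact: ppart_ge0.
- by move=> j ji; rewrite t0// normr0; lra.
Qed.

Lemma nsum_finType (T : finType) (u : T -> R) : (forall i, 0 <= u i) ->
  nsum u = (\sum_i u i)%:E.
Proof.
move=> u0; rewrite /nsum (_ : [set: T] = [set` enum T]); last first.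
  by apply/seteqP; split=> // i _ /=; rewrite mem_enum.
rewrite esum_fset//; last by move=> i _; rewrite lee_fin.
by rewrite -fsbig_seq ?enum_uniq// big_enum sumEFin.
Qed.

Lemma esum_swap (I J : choiceType) (a : I -> J -> \bar R) :
  (forall i j, (0 <= a i j)%E) ->
  \esum_(i in [set: I]) \esum_(j in [set: J]) a i j =
  \esum_(j in [set: J]) \esum_(i in [set: I]) a i j.
Proof.
move=> a0; rewrite !esum_esum//.
apply: (@reindex_esum _ _ _ _ _ (fun k : J * I => (k.2, k.1))
  (fun k => a k.1 k.2)); split => //.
- by move=> [j i] [j' i'] _ _ [-> ->].
- by move=> [i j] _; exists (j, i).
Qed.

Lemma nsum_swap (I J : choiceType) (u : I -> J -> R) :
  (forall i j, 0 <= u i j) ->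
  \esum_(i in [set: I]) nsum (u i) = \esum_(j in [set: J]) nsum (u^~ j).
Proof. by move=> u0; apply: esum_swap => i j; rewrite lee_fin. Qed.

Section Nested.
Context {I J : choiceType} (t : I -> J -> R).
Hypothesis st : (\esum_(i in [set: I]) nsum (fun j => `|t i j|%R) < +oo)%E.

Lemma abs_summable_inner i : abs_summable (t i).
Proof.
apply: le_lt_trans st; apply: esum_ge; exists [set i].
  by split => //; exact: finite_set1.
by rewrite fsbig_set1.
Qed.

Lemma asum_nested : asum (fun i => asum (t i)) =
  fine (\esum_(i in [set: I]) nsum (ppart (t i))) -
  fine (\esum_(i in [set: I]) nsum (npart (t i))).
Proof.
have fin (u : I -> J -> R) : (forall i j, 0 <= u i j <= `|t i j|) ->
    (\esum_(i in [set: I]) nsum (u i) < +oo)%E /\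
    forall i, nsum (u i) = (fine (nsum (u i)))%:E.
  move=> ut; split.
    apply: le_lt_trans st; apply: le_esum => i _; apply: le_nsum => j.
    by have /andP[] := ut i j.
  move=> i; rewrite fineK// nsum_fin_num//.
    by move=> j; have /andP[] := ut i j.
  apply: le_lt_trans (abs_summable_inner i); apply: le_nsum => j.
  by have /andP[] := ut i j.
have [pfin pE] := fin (fun i => ppart (t i)) (fun i j => introT andP
  (conj (ppart_ge0 (t i) j) (ppart_le (t i) j))).
have [nfin nE] := fin (fun i => npart (t i)) (fun i j => introT andP
  (conj (npart_ge0 (t i) j) (npart_le (t i) j))).
rewrite (_ : (fun i => asum (t i)) =
  (fun i => fine (nsum (ppart (t i))) - fine (nsum (npart (t i))))); last first.
  by apply/funext => i; rewrite asumE//; exact: abs_summable_inner.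
rewrite (eq_esum (fun i _ => pE i)) (eq_esum (fun i _ => nE i)).
rewrite (eq_esum (fun i _ => pE i)) in pfin.
rewrite (eq_esum (fun i _ => nE i)) in nfin.
by rewrite asum_sub// => i; rewrite fine_ge0// nsum_ge0// => j;
  [exact: ppart_ge0|exact: npart_ge0].
Qed.

End Nested.

(** Fubini for absolutely summable double families: both iterated sums are
    the difference of the double sums of the positive and of the negative parts,
    and those can be exchanged. *)
Lemma asum_swap (I J : choiceType) (t : I -> J -> R) :
  (\esum_(i in [set: I]) nsum (fun j => `|t i j|%R) < +oo)%E ->
  asum (fun i => asum (t i)) = asum (fun j => asum (t^~ j)).
Proof.
move=> st.
have st' : (\esum_(j in [set: J]) nsum (fun i => `|t i j|%R) < +oo)%E.
  by rewrite -(nsum_swap (u := fun i j => `|t i j|%R)).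
rewrite (asum_nested st) (asum_nested st').
congr (fine _ - fine _); apply: nsum_swap => i j.
  exact: ppart_ge0.
exact: npart_ge0.
Qed.

Section Exhaustion.
Context {I : choiceType} {T : nat -> finType} {e : forall N, T N -> I}.
Hypothesis e_inj : forall N, injective (@e N).
Hypothesis e_exh : forall i, \forall N \near \oo, exists a : T N, e a = i.

Lemma nsum_exhaustion (u : I -> R) : (forall i, 0 <= u i) ->
  (nsum u < +oo)%E ->
  (fun N => \sum_(a : T N) u (e a)) @ \oo --> fine (nsum u).
Proof.
move=> u0 ufin; have uf := nsum_fin_num u0 ufin.
have img N : (\sum_(a : T N) u (e a))%:E =
    (\sum_(i \in [set` map (@e N) (enum (T N))]) (u i)%:E)%E.
  rewrite -fsbig_seq ?big_map ?big_enum ?sumEFin//.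
  by rewrite (map_inj_uniq (@e_inj N)) enum_uniq.
apply/cvgrPdist_le => /= eps eps0.
have [_ [X [finX _] <-]] := ub_ereal_sup_adherent eps0 uf.
rewrite -[X in (X - _ < _)%E -> _]/(nsum u) -{1}(fineK uf) => Xlt.
have : \forall N \near \oo, forall i, X i -> exists a : T N, e a = i.
  have := @filter_bigI nat I (fset_set X)
    (fun i => [set N | exists a : T N, e a = i]) _ _ (fun i _ => e_exh i).
  move=> /(_ _); apply: filterS => N XN i Xi; apply: XN; by rewrite /= in_fset_set// inE.
apply: filterS => N XN.
have up : \sum_(a : T N) u (e a) <= fine (nsum u).
  rewrite -lee_fin fineK// img; apply: esum_ge; exists [set` map (@e N) (enum (T N))].
    by split => //; exact: finite_seq.
  by [].
have lo : (\sum_(i \in X) (u i)%:E <= (\sum_(a : T N) u (e a))%:E)%E.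
  rewrite img; apply: lee_fsum_nneg_subset => //.
  - move=> i; rewrite !inE => Xi; have [a <-] := XN _ Xi.
    by rewrite /= map_f// mem_enum.
  - by move=> i _; rewrite lee_fin.
rewrite ger0_norm ?subr_ge0//.
have := lt_le_trans Xlt lo; rewrite -EFinB lte_fin; lra.
Qed.

(** The order of summation is irrelevant: along any finite sets that
    eventually contain each given index, the partial sums tend to the
    unordered sum. It is used for the boxes of multi-indices and for the initial
    segments of the natural numbers. *)
Lemma asum_exhaustion (t : I -> R) : abs_summable t ->
  (fun N => \sum_(a : T N) t (e a)) @ \oo --> asum t.
Proof.
move=> st; rewrite asumE//.
rewrite (_ : (fun N => _) = (fun N => \sum_(a : T N) ppart t (e a) -
   \sum_(a : T N) npart t (e a))).
  by apply: cvgB; apply: nsum_exhaustion; [exact: ppart_ge0|exact: ppart_fin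
    |exact: npart_ge0|exact: npart_fin].
apply/funext => N; rewrite -sumrB; apply: eq_bigr => a _.
by rewrite /ppart /npart; lra.
Qed.

End Exhaustion.

End UnconditionalSums.

(** * The algebra of power series on a cube *)

Section PowerSeries.
Context {R : realType}.

Definition cube p (r : R) (h : 'rV[R]_p) : Prop := forall i, `|h 0 i| <= r.

Definition mdeg p (a : {ffun 'I_p -> nat}) : nat := (\sum_i a i)%N.

Definition madd p (a b : {ffun 'I_p -> nat}) : {ffun 'I_p -> nat} :=
  [ffun i => (a i + b i)%N].

(** The weighted l1 norm of the coefficients. With it the power series form a
    Banach algebra, whose norm dominates the supremum on the cube of radius [r]. *)
Definition psnorm p (r : R) (c : {ffun 'I_p -> nat} -> R) : \bar R :=
  nsum (fun a => `|c a| * r ^+ mdeg a).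

Definition psum p (c : {ffun 'I_p -> nat} -> R) (h : 'rV[R]_p) : R :=
  asum (fun a => c a * monomial h a).

(** [f] is on the cube of radius [r] the sum of a power series of norm at most
    [M]. The bound [M] is recorded because substitution requires the inner functions
    to have a small norm. *)
Definition expands p (r M : R) (f : 'rV[R]_p -> R) : Prop :=
  exists c, (psnorm r c <= M%:E)%E /\ forall h, cube r h -> f h = psum c h.

Section FixedDimension.
Context {p : nat}.
Implicit Types (a b : {ffun 'I_p -> nat}) (c : {ffun 'I_p -> nat} -> R)
  (h : 'rV[R]_p) (f g : 'rV[R]_p -> R).

Lemma cube0 (r : R) : 0 <= r -> cube r (0 : 'rV[R]_p).
Proof. by move=> r0 i; rewrite mxE normr0. Qed.

Lemma cube_le (r s : R) h : r <= s -> cube r h -> cube s h.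
Proof. by move=> rs hr i; exact: le_trans (hr i) rs. Qed.

Lemma monomialD h a b : monomial h (madd a b) = monomial h a * monomial h b.
Proof. by rewrite /monomial -big_split; apply: eq_bigr => i _; rewrite ffunE exprD. Qed.

Lemma mdegD a b : mdeg (madd a b) = (mdeg a + mdeg b)%N.
Proof. by rewrite /mdeg -big_split; apply: eq_bigr => i _; rewrite ffunE. Qed.

Lemma monomial_le (r : R) h a : cube r h -> `|monomial h a| <= r ^+ mdeg a.
Proof.
move=> hr; rewrite /monomial /mdeg normr_prod -prodrXr; apply: ler_prod => i _.
by rewrite normr_ge0 normrX lerXn2r// ?nnegrE ?normr_ge0 ?hr// (le_trans _ (hr i)).
Qed.

Lemma psnorm_le (r s : R) c : 0 <= r <= s -> (psnorm r c <= psnorm s c)%E.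
Proof.
move=> /andP[r0 rs]; apply: le_nsum => a; rewrite ler_wpM2l//.
by rewrite lerXn2r// ?nnegrE// (le_trans r0).
Qed.

Lemma psum_abs_summable (r : R) c h : 0 <= r -> cube r h ->
  (psnorm r c < +oo)%E -> abs_summable (fun a => c a * monomial h a).
Proof.
move=> r0 hr; apply: abs_summable_le => a.
by rewrite normrM ler_wpM2l// monomial_le.
Qed.

Lemma psnorm_lt (r M : R) c : (psnorm r c <= M%:E)%E -> (psnorm r c < +oo)%E.
Proof. by move=> /le_lt_trans; apply; rewrite ltry. Qed.

Lemma expands_ge0 (r M : R) f : 0 <= r -> expands r M f -> 0 <= M.
Proof.
move=> r0 [c [cM _]]; rewrite -lee_fin (le_trans _ cM)// nsum_ge0// => a.
by rewrite mulr_ge0// exprn_ge0.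
Qed.

Lemma expands_bound (r M : R) f h : 0 <= r -> expands r M f -> cube r h ->
  `|f h| <= M.
Proof.
move=> r0 [c [cM fc]] hr; rewrite fc//; apply: asum_norm_le.
apply: le_trans cM; apply: le_nsum => a.
by rewrite normrM ler_wpM2l// monomial_le.
Qed.

Lemma expands_eq (r M : R) f g : (forall h, cube r h -> f h = g h) ->
  expands r M f -> expands r M g.
Proof.
by move=> fg [c [cM fc]]; exists c; split=> // h hr; rewrite -fg// fc.
Qed.

Lemma expands_le (r s M N : R) f : 0 <= r <= s -> M <= N ->
  expands s M f -> expands r N f.
Proof.
move=> rs MN [c [cM fc]]; exists c; split.
  by rewrite (le_trans (psnorm_le c rs))// (le_trans cM)// lee_fin.
by move=> h hr; apply/fc/(cube_le _ hr); case/andP: rs.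
Qed.

(** Completeness of the algebra: an absolutely convergent series of power
    series is a power series, its coefficients being the sums of the coefficients
    by Fubini. Products, compositions and explicit expansions are all obtained by
    presenting a function as such a series of simpler ones. *)
Lemma expands_asum (K : choiceType) (r N : R) (M : K -> R)
    (F : K -> 'rV[R]_p -> R) f : 0 < r ->
  (forall k, expands r (M k) (F k)) -> (nsum M <= N%:E)%E ->
  (forall h, cube r h -> f h = asum (F ^~ h)) -> expands r N f.
Proof.
move=> r0 /choice[c cP] MN fF.
have summ (w : {ffun 'I_p -> nat} -> R) : (forall a, `|w a| <= r ^+ mdeg a) ->
    (\esum_(k in [set: K]) nsum (fun a => `|c k a * w a|%R) <= N%:E)%E.
  move=> wr; apply: le_trans MN; apply: le_esum => k _.
  apply: le_trans (cP k).1; apply: le_nsum => a.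
  by rewrite normrM ler_wpM2l.
have lt_fin x : (x <= N%:E -> x < +oo)%E.
  by move=> /le_lt_trans; apply; rewrite ltry.
have ra0 a : 0 < r ^+ mdeg a by rewrite exprn_gt0.
have summ_r := summ (fun a => r ^+ mdeg a) (fun a => (ltac:(by rewrite gtr0_norm))).
have summ_r' : (\esum_(a in [set: {ffun 'I_p -> nat}])
    nsum (fun k => `|c k a * r ^+ mdeg a|%R) <= N%:E)%E.
  by rewrite -(nsum_swap (u := fun k a => `|c k a * r ^+ mdeg a|%R)).
have inner_r a := abs_summable_inner (lt_fin _ summ_r') a.
have inner a : abs_summable (c ^~ a).
  have := abs_summableZ (r ^- mdeg a) (inner_r a).
  congr abs_summable; apply/funext => k.
  by rewrite mulrC mulfK// gt_eqF.
exists (fun a => asum (c ^~ a)); split.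
  apply: le_trans summ_r'; apply: le_esum => a _.
  have := asum_norm (inner_r a).
  under [X in asum X]eq_fun do rewrite mulrC.
  by rewrite asumZ// normrM (gtr0_norm (ra0 a)) mulrC.
move=> h hr; rewrite fF//.
have -> : F ^~ h = fun k => asum (fun a => c k a * monomial h a).
  by apply/funext => k; rewrite (cP k).2.
rewrite asum_swap; last first.
  by apply/lt_fin/summ => a; exact: monomial_le.
congr asum; apply/funext => a.
under [X in asum X]eq_fun do rewrite mulrC.
by rewrite asumZ// mulrC.
Qed.

Lemma expands_monomial (r t : R) b : 0 <= r ->
  expands r (`|t| * r ^+ mdeg b) (fun h => t * monomial h b).
Proof.
move=> r0; pose c a := if a == b then t else 0.
have cz a : a != b -> c a = 0 by rewrite /c => /negbTE ->.
have cb : c b = t by rewrite /c eqxx.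
exists c; split.
  have dz a : a != b -> c a * r ^+ mdeg a = 0 by move=> ab; rewrite cz// mul0r.
  have [+ _] := asum_single dz.
  rewrite cb normrM (ger0_norm (exprn_ge0 _ r0)) => <-.
  by apply: le_nsum => a; rewrite normrM (ger0_norm (exprn_ge0 _ r0)).
move=> h _.
have dz a : a != b -> c a * monomial h a = 0 by move=> ab; rewrite cz// mul0r.
by rewrite /psum (asum_single dz).2 cb.
Qed.

Lemma expandsZ (r M k : R) f : 0 < r ->
  expands r M f -> expands r (`|k| * M) (fun h => k * f h).
Proof.
move=> r0 [c [cM fc]]; exists (fun a => k * c a); split.
  apply: (@le_trans _ _ (`|k|%:E * psnorm r c)%E).
    rewrite /psnorm -nsumZ//; last by move=> a; rewrite mulr_ge0// exprn_ge0// ltW.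
    by apply: le_nsum => a; rewrite normrM mulrA.
  by rewrite EFinM; apply: lee_wpmul2l; rewrite ?lee_fin.
move=> h hr; rewrite fc// /psum -asumZ//.
  by congr asum; apply/funext => a; rewrite mulrA.
exact: (psum_abs_summable (ltW r0) hr (psnorm_lt cM)).
Qed.

Lemma expandsD (r M N : R) f g : 0 < r -> expands r M f -> expands r N g ->
  expands r (M + N) (fun h => f h + g h).
Proof.
move=> r0 [c [cM fc]] [d [dN gd]]; exists (fun a => c a + d a); split.
  apply: (@le_trans _ _ (psnorm r c + psnorm r d)%E); last first.
    by rewrite EFinD leeD.
  rewrite /psnorm -nsumD//; try by move=> a; rewrite mulr_ge0// exprn_ge0// ltW.
  apply: le_nsum => a; rewrite -mulrDl ler_wpM2r ?ler_normD//.
  by rewrite exprn_ge0// ltW.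
move=> h hr; rewrite fc// gd// /psum -asumD//.
- by congr asum; apply/funext => a; rewrite mulrDl.
- exact: (psum_abs_summable (ltW r0) hr (psnorm_lt cM)).
- exact: (psum_abs_summable (ltW r0) hr (psnorm_lt dN)).
Qed.

Lemma expands_mul_monomial (r N : R) b g : 0 < r -> expands r N g ->
  expands r (r ^+ mdeg b * N) (fun h => monomial h b * g h).
Proof.
move=> r0 [d [dN gd]].
apply: (@expands_asum _ r _ (fun a => `|d a| * r ^+ mdeg (madd b a))
  (fun a h => d a * monomial h (madd b a))) => //.
- by move=> a; apply: expands_monomial; exact: ltW.
- rewrite (_ : (fun a => _) = (fun a => r ^+ mdeg b * (`|d a| * r ^+ mdeg a))).
    rewrite nsumZ ?(exprn_ge0 _ (ltW r0))//; last first.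
      by move=> a; rewrite mulr_ge0// exprn_ge0// ltW.
    by rewrite EFinM; apply: lee_wpmul2l; rewrite ?lee_fin// exprn_ge0// ltW.
  by apply/funext => a; rewrite mdegD exprD; ring.
- move=> h hr; rewrite gd// /psum -asumZ//.
    by congr asum; apply/funext => a; rewrite monomialD; ring.
  exact: (psum_abs_summable (ltW r0) hr (psnorm_lt dN)).
Qed.

(** Expanding [f] presents the product as the series of the functions
    [c a * monomial h a * g h], to which completeness applies. *)
Lemma expandsM (r M N : R) f g : 0 < r -> expands r M f -> expands r N g ->
  expands r (M * N) (fun h => f h * g h).
Proof.
move=> r0 [c [cM fc]] eg; have N0 := expands_ge0 (ltW r0) eg.
apply: (@expands_asum _ r _ (fun a => `|c a| * (r ^+ mdeg a * N))
  (fun a h => c a * (monomial h a * g h))) => //.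
- by move=> a; apply/expandsZ/expands_mul_monomial.
- rewrite (_ : (fun a => _) = (fun a => N * (`|c a| * r ^+ mdeg a))).
    rewrite nsumZ//; last by move=> a; rewrite mulr_ge0// exprn_ge0// ltW.
    by rewrite muleC EFinM; apply: lee_wpmul2r; rewrite ?lee_fin.
  by apply/funext => a; ring.
- move=> h hr; rewrite fc// mulrC /psum -asumZ//.
    by congr asum; apply/funext => a; ring.
  exact: (psum_abs_summable (ltW r0) hr (psnorm_lt cM)).
Qed.

Lemma expands_cst (r k : R) : 0 <= r -> expands r `|k| (fun _ : 'rV[R]_p => k).
Proof.
move=> r0; have := @expands_monomial r k [ffun=> 0%N] r0.
rewrite /mdeg big1 => [|i _]; last by rewrite ffunE.
rewrite expr0 mulr1; apply: expands_eq => h _.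
by rewrite /monomial big1 ?mulr1// => i _; rewrite ffunE expr0.
Qed.

Lemma expands_exp (r M : R) f n : 0 < r -> expands r M f ->
  expands r (M ^+ n) (fun h => f h ^+ n).
Proof.
move=> r0 ef; elim: n => [|n IHn].
  have := @expands_cst r 1 (ltW r0); rewrite normr1 expr0.
  by apply: expands_eq => h _; rewrite expr0.
rewrite exprS; apply: expands_eq (expandsM r0 ef IHn) => h _.
by rewrite exprS.
Qed.

Lemma expands_prod (I : Type) (s : seq I) (r : R) (M : I -> R)
    (F : I -> 'rV[R]_p -> R) : 0 < r -> (forall i, expands r (M i) (F i)) ->
  expands r (\prod_(i <- s) M i) (fun h => \prod_(i <- s) F i h).
Proof.
move=> r0 eF; elim: s => [|i s IHs].
  have := @expands_cst r 1 (ltW r0); rewrite normr1 big_nil.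
  by apply: expands_eq => h _; rewrite big_nil.
rewrite big_cons; apply: expands_eq (expandsM r0 (eF i) IHs) => h _.
by rewrite big_cons.
Qed.

Lemma psum0 c : psum c 0 = c [ffun=> 0%N].
Proof.
have dz a : a != [ffun=> 0%N] -> c a * monomial 0 a = 0.
  move=> an0; have [i ai] : exists i, a i != 0%N.
    apply/existsP; apply: contraNT an0; rewrite negb_exists => /forallP a0.
    by apply/eqP/ffunP => i; rewrite ffunE; apply/eqP; rewrite -[_ == _]negbK.
  by rewrite /monomial (bigD1 i)//= mxE expr0n (negbTE ai) mul0r mulr0.
rewrite /psum (asum_single dz).2 /monomial big1 ?mulr1// => i _.
by rewrite ffunE expr0.
Qed.

Lemma mdeg_eq0 a : (mdeg a == 0%N) = (a == [ffun=> 0%N]).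
Proof.
rewrite sum_nat_eq0; apply/forallP/eqP => [a0|-> i]; last by rewrite ffunE.
by apply/ffunP => i; rewrite ffunE; exact/eqP/a0.
Qed.

(** Without constant term every monomial gains at least one factor [s / r]
    when the cube shrinks, so the norm becomes as small as desired. This is what
    puts the inner functions of a composition inside the domain of the outer one. *)
Lemma expands_small (r s M : R) f : 0 < s <= r -> f 0 = 0 -> expands r M f ->
  expands s (s / r * M) f.
Proof.
move=> /andP[s0 sr] f0 [c [cM fc]]; have r0 := lt_le_trans s0 sr.
have c0 : c [ffun=> 0%N] = 0 by rewrite -psum0 -fc//; apply: cube0; exact: ltW.
have sr0 : 0 <= s / r by rewrite divr_ge0// ltW.
exists c; split; last by move=> h hs; apply/fc/(cube_le sr hs).
apply: (@le_trans _ _ ((s / r)%:E * psnorm r c)%E); last first.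
  by rewrite [leRHS]EFinM; apply: lee_wpmul2l; rewrite ?lee_fin.
rewrite /psnorm -nsumZ//; last by move=> a; rewrite mulr_ge0// exprn_ge0// ltW.
apply: le_nsum => a; case E: (mdeg a) => [|n].
  by move/eqP: E; rewrite mdeg_eq0 => /eqP ->; rewrite c0 normr0 !mul0r mulr0.
rewrite mulrCA ler_wpM2l// !exprS.
rewrite (_ : s / r * _ = s * r ^+ n); last by field; rewrite gt_eqF.
by rewrite ler_pM2l// lerXn2r// nnegrE ltW.
Qed.

(** Substitution: each term of the outer series becomes a product of powers of
    the inner functions, of norm at most [rho ^+ mdeg k], so these terms form an
    absolutely convergent series in the algebra. *)
Lemma expands_psum q (r rho M : R) (c : {ffun 'I_q -> nat} -> R)
    (G : 'I_q -> 'rV[R]_p -> R) : 0 < r -> 0 <= rho ->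
  (psnorm rho c <= M%:E)%E -> (forall j, expands r rho (G j)) ->
  expands r M (fun h => psum c (\row_j G j h)).
Proof.
move=> r0 rho0 cM eG.
apply: (@expands_asum _ r _ (fun k => `|c k| * \prod_j rho ^+ k j)
  (fun k h => c k * \prod_j G j h ^+ k j)) => //.
- move=> k; apply: expandsZ => //; apply: expands_prod => // j.
  exact: expands_exp.
- apply: le_trans cM; apply: le_nsum => k.
  by rewrite prodrXr.
- move=> h _; congr asum; apply/funext => k; congr (_ * _).
  by apply: eq_bigr => j _; rewrite mxE.
Qed.

End FixedDimension.
End PowerSeries.

(** * Closure properties of analyticity at a point *)

Section AnalyticFunctions.
Context {R : realType}.

Lemma multi_sum_asum p (u : {ffun 'I_p -> nat} -> R) : abs_summable u ->
  multi_sum u (asum u).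
Proof.
move=> su; split; first exact: su.
apply: (asum_exhaustion (T := fun N => {ffun 'I_p -> 'I_N})
  (e := fun N a => [ffun i => val (a i)])) su => [N a b /ffunP ab|b].
  by apply/ffunP => i; apply/val_inj; have := ab i; rewrite !ffunE.
near=> N; have bN i : (b i < N)%N.
  apply: leq_ltn_trans (leq_bigmax i) _.
  by near: N; exists (\max_i b i).+1.
by exists [ffun i => Ordinal (bN i)]; apply/ffunP => i; rewrite !ffunE.
Unshelve. all: by end_near. Qed.

Lemma multi_sumE p (u : {ffun 'I_p -> nat} -> R) s : multi_sum u s ->
  abs_summable u /\ s = asum u.
Proof.
move=> [su cvs]; split=> //.
exact: (cvg_unique (@Rhausdorff R) cvs (multi_sum_asum su).2).
Qed.

(** Shrinking the polydisc turns pointwise absolute convergence into a finite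
    norm: at the corner of the smaller cube the terms of the series are, up to
    sign, those of the norm. *)
Lemma analytic_atP p (f : 'rV[R]_p -> R) x : analytic_at f x <->
  exists r M : R, 0 < r /\ expands r M (fun h => f (x + h)).
Proof.
split=> [[r [c [r0 fc]]]|[r [M [r0 [c [cM fc]]]]]].
- pose s := r / 2; have s0 : 0 < s by rewrite divr_gt0.
  have sr : s < r by rewrite /s; lra.
  have ns : (psnorm s c < +oo)%E.
    have [|su _] := multi_sumE (fc (const_mx s) _).
      by move=> i; rewrite mxE gtr0_norm.
    apply: le_lt_trans su; apply: le_nsum => a; rewrite normrM ler_wpM2l//.
    rewrite /monomial; under eq_bigr do rewrite mxE.
    by rewrite prodrXr ger0_norm// exprn_ge0// ltW.
  exists s, (fine (psnorm s c)); split=> //; exists c; split.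
    rewrite fineK// nsum_fin_num// => a.
    by rewrite mulr_ge0// exprn_ge0// ltW.
  move=> h hs; apply: (multi_sumE (fc h _)).2 => i.
  exact: le_lt_trans (hs i) sr.
- exists r, c; split=> // h hr.
  have hr' : cube r h by move=> i; exact/ltW/hr.
  rewrite fc//; apply: multi_sum_asum.
  exact: (psum_abs_summable (ltW r0) hr' (psnorm_lt cM)).
Qed.

(** Analyticity depends on the germ of the function only. *)
Lemma analytic_at_local p (f g : 'rV[R]_p -> R) x (r : R) : 0 < r ->
  (forall h, cube r h -> f (x + h) = g (x + h)) ->
  analytic_at f x -> analytic_at g x.
Proof.
move=> r0 fg /analytic_atP[s [M [s0 ef]]]; apply/analytic_atP.
exists (Num.min r s), M; split; first by rewrite lt_min r0.
apply: (@expands_eq _ _ _ _ (fun h => f (x + h))).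
  by move=> h hr; apply/fg/(cube_le _ hr); rewrite ge_min lexx.
apply: expands_le (lexx _) ef.
by rewrite ge_min lexx orbT le_min !ltW.
Qed.

Lemma analytic_at_cst p (k : R) (x : 'rV[R]_p) : analytic_at (fun=> k) x.
Proof.
by apply/analytic_atP; exists 1, `|k|; split=> //; exact: expands_cst.
Qed.

Lemma common_radius n (r : 'I_n -> R) : (forall i, 0 < r i) ->
  exists2 s, 0 < s & forall i, s <= r i.
Proof.
move=> r0; exists (\big[Order.min/1]_i r i) => [|i]; last exact: bigmin_le.
by elim/big_ind: _ => // a b a0 b0; rewrite lt_min a0.
Qed.

Lemma analytic_atD p (f g : 'rV[R]_p -> R) x : analytic_at f x ->
  analytic_at g x -> analytic_at (fun v => f v + g v) x.
Proof.
move=> /analytic_atP[r [M [r0 ef]]] /analytic_atP[s [N [s0 eg]]].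
apply/analytic_atP; exists (Num.min r s), (M + N).
have m0 : 0 < Num.min r s by rewrite lt_min r0.
split=> //; apply: expandsD => //.
- by apply: expands_le (lexx _) ef; rewrite ge_min lexx ltW.
- by apply: expands_le (lexx _) eg; rewrite ge_min lexx orbT ltW.
Qed.

Lemma analytic_atM p (f g : 'rV[R]_p -> R) x : analytic_at f x ->
  analytic_at g x -> analytic_at (fun v => f v * g v) x.
Proof.
move=> /analytic_atP[r [M [r0 ef]]] /analytic_atP[s [N [s0 eg]]].
apply/analytic_atP; exists (Num.min r s), (M * N).
have m0 : 0 < Num.min r s by rewrite lt_min r0.
split=> //; apply: expandsM => //.
- by apply: expands_le (lexx _) ef; rewrite ge_min lexx ltW.
- by apply: expands_le (lexx _) eg; rewrite ge_min lexx orbT ltW.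
Qed.

Lemma analytic_at_sum p (I : Type) (s : seq I) (F : I -> 'rV[R]_p -> R) x :
  (forall i, analytic_at (F i) x) ->
  analytic_at (fun v => \sum_(i <- s) F i v) x.
Proof.
move=> aF; elim: s => [|i s IHs].
  rewrite (_ : (fun v => _) = fun=> 0); first exact: analytic_at_cst.
  by apply/funext => v; rewrite big_nil.
rewrite (_ : (fun v => _) = fun v => F i v + \sum_(j <- s) F j v).
  exact: analytic_atD.
by apply/funext => v; rewrite big_cons.
Qed.

Lemma analytic_at_coord p (i : 'I_p) (x : 'rV[R]_p) :
  analytic_at (fun v => v 0 i) x.
Proof.
rewrite (_ : (fun v => _) = (fun v => (fun=> x 0 i) v + (fun v => (v - x) 0 i) v)).
  apply: analytic_atD; first exact: analytic_at_cst.
  apply/analytic_atP; pose b : {ffun 'I_p -> nat} := [ffun j => (j == i) : nat].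
  exists 1, (`|1| * 1 ^+ mdeg b); split=> //.
  apply: expands_eq (expands_monomial 1 b ler01) => h _.
  rewrite mul1r addrAC subrr add0r /monomial (bigD1 i)//= ffunE eqxx expr1.
  by rewrite big1 ?mulr1// => j /negbTE ji; rewrite ffunE ji expr0.
by apply/funext => v; rewrite !mxE; ring.
Qed.

Lemma analytic_at_comp p q (g : 'rV[R]_q -> R) (F : 'rV[R]_p -> 'rV[R]_q) x :
  analytic_at g (F x) -> (forall j, analytic_at (fun v => F v 0 j) x) ->
  analytic_at (fun v => g (F v)) x.
Proof.
move=> /analytic_atP[rho [M [rho0 [c [cM gc]]]]] aF.
have small j : exists s, 0 < s /\
    expands s rho (fun h => F (x + h) 0 j - F x 0 j).
  have /analytic_atP[r [N [r0 eF]]] := aF j.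
  have := expandsD r0 eF (expands_cst (- F x 0 j) (ltW r0)).
  set N' := N + _ => eF'.
  have N'0 : 0 <= N' := expands_ge0 (ltW r0) eF'.
  (* On the cube of radius s the norm of the increment is at most s / r * N'; the
     denominator N' + 1 avoids a division by zero. *)
  exists (Num.min r (rho * r / (N' + 1))); set s := Num.min _ _.
  have s0 : 0 < s by rewrite lt_min r0 divr_gt0 ?mulr_gt0// ltr_wpDl.
  have sr : s <= r by rewrite ge_min lexx.
  split=> //.
  have := @expands_small _ _ r s N' (fun h => F (x + h) 0 j - F x 0 j).
  rewrite s0 sr addr0 subrr => /(_ isT erefl eF').
  apply: expands_le; first by rewrite lexx ltW.
  have sN : s * (N' + 1) <= rho * r.
    by rewrite -ler_pdivlMr ?ltr_wpDl// ge_min lexx orbT.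
  rewrite mulrAC ler_pdivrMr//.
  by rewrite (le_trans _ sN)// ler_wpM2l ?(ltW s0)// lerDl.
have [s_ sP] := choice small.
have [s s0 ss] := common_radius (fun j => (sP j).1).
apply/analytic_atP; exists s, M; split=> //.
have eG j : expands s rho (fun h => F (x + h) 0 j - F x 0 j).
  by apply: expands_le (lexx _) (sP j).2; rewrite ltW//=.
apply: expands_eq (expands_psum s0 (ltW rho0) cM eG) => h hs.
rewrite -gc => [|j]; last by rewrite mxE (expands_bound (ltW s0) (eG j)).
by congr g; apply/rowP => j; rewrite !mxE; ring.
Qed.

Lemma nsum_nat_le (u : nat -> R) (B : R) : (forall n, 0 <= u n) ->
  (forall N, \sum_(i < N) u i <= B) -> (nsum u <= B%:E)%E.
Proof.
move=> u0 uB; rewrite /nsum -nneseries_esumT => [|n]; last by rewrite lee_fin.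
apply: lime_le; first by apply: is_cvg_nneseries => *; rewrite lee_fin.
by near=> N; rewrite sumEFin lee_fin big_mkord.
Unshelve. all: by end_near. Qed.

(** The criterion for functions of one variable given by a classical power
    series: bounded partial sums of the norm, and convergence to the function. *)
Lemma analytic_at_series (f : R -> R) (x : 'rV[R]_1) (t : nat -> R) (r B : R) :
  0 < r -> (forall N, \sum_(i < N) `|t i| * r ^+ i <= B) ->
  (forall h, `|h| <= r ->
    (fun N => \sum_(i < N) t i * h ^+ i) @ \oo --> f (x 0 0 + h)) ->
  analytic_at (fun v : 'rV[R]_1 => f (v 0 0)) x.
Proof.
move=> r0 tB ft; have tr0 n : 0 <= `|t n| * r ^+ n.
  by rewrite mulr_ge0// exprn_ge0// ltW.
have tB' := nsum_nat_le tr0 tB.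
apply/analytic_atP; exists r, B; split=> //.
apply: (@expands_asum _ _ _ _ _ (fun n => `|t n| * r ^+ n)
  (fun n h => t n * h 0 0 ^+ n)) => //.
- move=> n; have := expands_monomial (t n) [ffun i : 'I_1 => n] (ltW r0).
  rewrite /mdeg big_ord1 ffunE; apply: expands_eq => h _.
  by rewrite /monomial big_ord1 ffunE.
- move=> h hr; rewrite mxE; apply: (cvg_unique (@Rhausdorff R) (ft _ (hr 0))).
  apply: (asum_exhaustion (T := fun N => 'I_N) (e := fun N i => val i)).
  + by move=> N; exact: val_inj.
  + move=> i; near=> N; have iN : (i < N)%N by near: N; exists i.+1.
    by exists (Ordinal iN).
  + apply: (abs_summable_le _ (le_lt_trans tB' (ltry _))) => n.
    by rewrite normrM ler_wpM2l// normrX lerXn2r// ?nnegrE ltW.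
Unshelve. all: by end_near. Qed.

Lemma analytic_at_expR (x : 'rV[R]_1) :
  analytic_at (fun v : 'rV[R]_1 => expR (v 0 0)) x.
Proof.
have expE h : (fun N => \sum_(i < N) i`!%:R^-1 * h ^+ i) = series (exp_coeff h).
  by apply/funext => N; rewrite /series/= big_mkord exp_coeffE.
apply: (@analytic_at_series _ _ (fun i => expR (x 0 0) * i`!%:R^-1) 1
  (expR (x 0 0) * expR 1)) => // [N|h _].
- rewrite (eq_bigr (fun i : 'I_N => expR (x 0 0) * (i`!%:R^-1 * 1 ^+ i))).
    rewrite -mulr_sumr ler_wpM2l ?expR_ge0//.
    rewrite [leLHS](_ : _ = series (exp_coeff 1) N); last by rewrite -expE.
    apply: nondecreasing_cvgn_le; last exact: is_cvg_series_exp_coeff.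
    apply: nondecreasing_series => n _ _; exact: exp_coeff_ge0.
  by move=> i _; rewrite ger0_norm ?mulrA// mulr_ge0 ?expR_ge0.
- rewrite expRD (_ : (fun N => _) =
    (fun N => expR (x 0 0) * series (exp_coeff h) N)).
    by apply: cvgMr; exact: is_cvg_series_exp_coeff.
  apply/funext => N; rewrite -expE mulr_sumr; apply: eq_bigr => i _.
  by rewrite mulrA.
Qed.

(** The geometric series of ratio [- h / y], on a cube of half the distance to
    the pole. *)
Lemma analytic_at_inv (x : 'rV[R]_1) : x 0 0 != 0 ->
  analytic_at (fun v : 'rV[R]_1 => (v 0 0)^-1) x.
Proof.
set y := x 0 0 => y0; have ny0 : 0 < `|y| by rewrite normr_gt0.
have geomE (z : R) N : 1 - z != 0 ->
    \sum_(i < N) z ^+ i = (1 - z ^+ N) / (1 - z).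
  move=> z1; have := subrX1 z N => E.
  apply: (mulIf z1); rewrite divfK// -opprB -[RHS]opprB E; ring.
have coefE h N : \sum_(i < N) (y^-1 * (- y^-1) ^+ i) * h ^+ i =
    y^-1 * \sum_(i < N) (- (h / y)) ^+ i.
  rewrite mulr_sumr; apply: eq_bigr => i _.
  by rewrite -mulrA -exprMn mulNr mulrC [h / y]mulrC mulrC.
apply: (@analytic_at_series _ _ (fun i => y^-1 * (- y^-1) ^+ i) (`|y| / 2)
  (2 / `|y|)) => [|N|h hr].
- by rewrite divr_gt0.
- rewrite (eq_bigr (fun i : 'I_N => `|y|^-1 * 2^-1 ^+ i)).
    rewrite -mulr_sumr geomE; last by rewrite lt0r_neq0//; lra.
    rewrite mulrC ler_wpM2r ?invr_ge0//.
    have : 0 <= (2^-1 : R) ^+ N by rewrite exprn_ge0.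
    move: (_ ^+ N) => z z0; rewrite ler_pdivrMr; lra.
  move=> i _; rewrite normrM normrX normrN normfV -mulrA -exprMn.
  by congr (_ * _ ^+ _); field; rewrite gt_eqF.
- have z1 : `|- (h / y)| < 1.
    by rewrite normrN normrM normfV ltr_pdivrMr// mul1r; lra.
  have z1' : 1 - (- (h / y)) != 0.
    by apply: contraTneq z1 => /eqP; rewrite subr_eq0 => /eqP <-; rewrite normr1 ltxx.
  rewrite (_ : (fun N => _) = (fun N => y^-1 * ((1 - (- (h / y)) ^+ N) / (1 - - (h / y))))); last first.
    by apply/funext => N; rewrite coefE geomE.
  rewrite (_ : (y + h)^-1 = y^-1 * ((1 - 0) / (1 - - (h / y)))).
    apply: cvgMr; apply: cvgMl; apply: cvgB; first exact: cvg_cst.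
    exact: cvg_expr.
  rewrite (_ : y + h = y * (1 - - (h / y))); last by field.
  by rewrite invfM subr0 mul1r.
Qed.

End AnalyticFunctions.

(** * Null sets *)

Section NullSets.
Context {R : realType} {p : nat}.
Implicit Types (A B : set 'rV[R]_p).

Definition volume (a b : 'rV[R]_p) : R := \prod_(i < p) (b 0 i - a 0 i).

Lemma volume_ge0 (a b : 'rV[R]_p) : (forall i, a 0 i <= b 0 i) -> 0 <= volume a b.
Proof. by move=> ab; apply: prodr_ge0 => i _; rewrite subr_ge0. Qed.

(** The covers in the outer measure are indexed by sets of natural numbers;
    through the encoding of a countable type any countable family of boxes may be
    used, in particular pairs of indices and the cells of a grid. *)
Lemma lebesgue_outer_cover (K : countType) (E : set K) (a b : K -> 'rV[R]_p) A :
  (forall k i, a k 0 i <= b k 0 i) ->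
  A `<=` \bigcup_(k in E) box (a k) (b k) ->
  (lebesgue_outer A <= \esum_(k in E) (volume (a k) (b k))%:E)%E.
Proof.
move=> ab AE; pose dec (c : K -> 'rV[R]_p) n := oapp c 0 (unpickle n).
apply: ereal_inf_lbound; exists (pickle @` E), (dec a), (dec b); split.
- by move=> n i; rewrite /dec; case: (unpickle n) => //=; rewrite mxE.
- move=> x /AE[k Ek xk]; exists (pickle k); first by exists k.
  by rewrite /dec pickleK.
- rewrite esum_image; last by move=> x y _ _; exact: (pcan_inj pickleK).
  by apply: eq_esum => k _; rewrite /dec pickleK.
Qed.

Lemma measure_zero_small A :
  (forall eps : R, 0 < eps -> (lebesgue_outer A <= eps%:E)%E) -> measure_zero A.
Proof.
move=> Aeps; apply/eqP; rewrite eq_le; apply/andP; split.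
  by apply/lee_addgt0Pr => e e0; rewrite add0e Aeps.
apply: le_ereal_inf_tmp => _ [D [a [b [ab _ ->]]]].
by apply: esum_ge0 => k _; rewrite lee_fin; exact: volume_ge0.
Qed.

Lemma measure_zero_sub A B : A `<=` B -> measure_zero B -> measure_zero A.
Proof.
move=> AB B0; apply: measure_zero_small => e e0.
apply: (@le_trans _ _ (lebesgue_outer B)); last by rewrite B0 lee_fin ltW.
apply: le_ereal_inf => _ [D [a [b [ab BD ->]]]]; exists D, a, b; split=> //.
exact: subset_trans BD.
Qed.

Lemma measure_zero_cover A (eps : R) : measure_zero A -> 0 < eps ->
  exists (D : set nat) (a b : nat -> 'rV[R]_p),
    [/\ forall k i, a k 0 i <= b k 0 i,
        A `<=` \bigcup_(k in D) box (a k) (b k) &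
        (\esum_(k in D) (volume (a k) (b k))%:E <= eps%:E)%E].
Proof.
move=> A0 eps0; have : (lebesgue_outer A < eps%:E)%E by rewrite A0 lte_fin.
move=> /ereal_inf_lt[_ [D [a [b [ab AD ->]]]] lt_eps].
by exists D, a, b; split=> //; exact: ltW.
Qed.

(** The usual distribution of [e] as the sum of the [e / 2 ^ n.+1], with a
    cover indexed by pairs. *)
Lemma measure_zero_bigcup (A : nat -> set 'rV[R]_p) :
  (forall n, measure_zero (A n)) -> measure_zero (\bigcup_n A n).
Proof.
move=> A0; apply: measure_zero_small => e e0.
have e2 n : 0 < e / (2 ^ n.+1)%:R by rewrite divr_gt0// ltr0n expn_gt0.
have /choice[D /choice[a /choice[b abP]]] n := measure_zero_cover (A0 n) (e2 n).
apply: (@le_trans _ _ (\esum_(k in [set: nat] `*`` D)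
    (volume (a k.1 k.2) (b k.1 k.2))%:E)%E).
  apply: lebesgue_outer_cover => [k i|x [n _ An]]; first by have [] := abP k.1.
  have [_ /(_ x An)[k Dk xk] _] := abP n.
  by exists (n, k).
rewrite -(esum_esum (a := fun n k => (volume (a n k) (b n k))%:E)); last first.
  by move=> n k _ _; rewrite lee_fin; apply: volume_ge0; have [] := abP n.
apply: (@le_trans _ _ (\esum_(n in [set: nat]) (e / (2 ^ n.+1)%:R)%:E)%E).
  by apply: le_esum => n _; have [] := abP n.
rewrite -nneseries_esumT; last by move=> n; rewrite lee_fin ltW.
have := @epsilon_trick R (fun=> 0%E) e xpredT (fun=> lexx _) (ltW e0).
rewrite [X in (_ <= X + _)%E]eseries0// add0e; apply: le_trans.
by apply: lee_nneseries => n _; rewrite ?add0e// lee_fin ltW.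
Qed.

Lemma measure_zero_set0 : measure_zero (set0 : set 'rV[R]_p).
Proof.
apply: measure_zero_small => e e0.
apply: (@le_trans _ _ (\esum_(k in set0) (volume 0 0)%:E)%E).
  by apply: (@lebesgue_outer_cover nat set0 (fun=> 0) (fun=> 0)).
by rewrite esum_set0 lee_fin ltW.
Qed.

Lemma measure_zero_countable (K : countType) (E : set K)
    (A : K -> set 'rV[R]_p) :
  (forall k, E k -> measure_zero (A k)) -> measure_zero (\bigcup_(k in E) A k).
Proof.
move=> A0.
pose B n := if unpickle n is Some k then [set x | E k /\ A k x] else set0.
apply: (@measure_zero_sub _ (\bigcup_n B n)).
  by move=> x [k Ek Akx]; exists (pickle k) => //; rewrite /B pickleK.
apply: measure_zero_bigcup => n; rewrite /B.
case: (unpickle n) => [k|]; last exact: measure_zero_set0.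
have [Ek|nEk] := pselect (E k); last first.
  by apply: measure_zero_sub measure_zero_set0 => x [].
by apply: measure_zero_sub (A0 k Ek) => x [].
Qed.

Lemma measure_zeroU A B : measure_zero A -> measure_zero B ->
  measure_zero (A `|` B).
Proof.
move=> A0 B0; apply: (@measure_zero_sub _
    (\bigcup_(k in [set: bool]) if k then A else B)).
  by move=> x [Ax|Bx]; [exists true|exists false].
by apply: measure_zero_countable => -[].
Qed.

Lemma measure_zero_translate A (x : 'rV[R]_p) : measure_zero A ->
  measure_zero [set y | A (y - x)].
Proof.
move=> A0; apply: measure_zero_small => e e0.
have [D [a [b [ab AD Ae]]]] := measure_zero_cover A0 e0.
apply: le_trans Ae; rewrite [leRHS](_ : _ =
    \esum_(k in D) (volume (a k + x) (b k + x))%:E).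
  apply: lebesgue_outer_cover => [k i|y /AD[k Dk yk]].
    by rewrite !mxE lerD2r.
  by exists k => // i; have /andP[] := yk i; rewrite !mxE => ? ?; apply/andP; split; lra.
apply: eq_esum => k _; congr _%:E; apply: eq_bigr => i _; rewrite !mxE; ring.
Qed.

(** Lindelof: every neighbourhood of a point contains a cube with rational centre
    and radius [1 / n.+1] around the point, and there are countably many of these. *)
Lemma measure_zero_local A :
  (forall x, A x -> exists2 r : R, 0 < r &
    measure_zero [set y | A y /\ cube r (y - x)]) -> measure_zero A.
Proof.
move=> loc.
pose Q (k : {ffun 'I_p -> rat} * nat) :=
  [set y : 'rV[R]_p | A y /\ cube k.2.+1%:R^-1 (y - \row_i ratr (k.1 i))].
apply: (@measure_zero_sub _ (\bigcup_(k in [set k | measure_zero (Q k)]) Q k)).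
  move=> x Ax; have [r r0 xr] := loc x Ax.
  have [n nr] : exists n : nat, 2 * n.+1%:R^-1 <= r.
    exists (Num.truncn (2 / r)); rewrite ler_pdivrMr// mulrC -ler_pdivrMr//.
    by rewrite ltW// truncnS_gt.
  have n0 : (0 : R) < n.+1%:R^-1 by rewrite invr_gt0.
  have /choice[q qx] : forall i, exists q : rat,
      `|x 0 i - ratr q| <= n.+1%:R^-1.
    move=> i; have xn : x 0 i < x 0 i + n.+1%:R^-1 by rewrite ltrDl.
    have [q /[!in_itv]/= /andP[q1 q2]] := rat_in_itvoo xn.
    exists q; rewrite ler_norml; move: (n.+1%:R^-1) q1 q2 {xn} => e q1 q2.
    by apply/andP; split; lra.
  have qE i : (\row_i ratr ([ffun i => q i] i)) 0 i = ratr (q i) :> R.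
    by rewrite mxE ffunE.
  exists ([ffun i => q i], n) => /=; last first.
    by split=> // i; rewrite !mxE ffunE.
  apply: measure_zero_sub xr => y [Ay yq]; split=> // i.
  have := yq i; have := qx i; rewrite !mxE/= ffunE; move: nr n0.
  move: (n.+1%:R^-1) => e nr e0; rewrite !ler_norml => /andP[? ?] /andP[? ?].
  by apply/andP; split; lra.
by apply: measure_zero_countable.
Qed.

Lemma subdivision_cell (w t : R) n : 0 <= w -> 0 <= t <= n.+1%:R * w ->
  exists k : 'I_n.+1, k%:R * w <= t <= k.+1%:R * w.
Proof.
move=> w0; elim: n => [|n IHn] tn; first by exists ord0; rewrite mul0r.
have [tle|tgt] := leP t (n.+1%:R * w).
  have [|k kt] := IHn; first by rewrite tle; case/andP: tn => ->.
  by exists (widen_ord (leqnSn _) k).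
by exists ord_max; rewrite ltW//=; case/andP: tn.
Qed.

(** Such a set is a Lipschitz graph over the other coordinates. Over each of the
    [n.+1 ^ (p - 1)] cells of side [w] of a grid in these coordinates, the set lies in
    an interval of length of order [w] in the coordinate [i]; the total volume is
    thus of order [w], which tends to 0. *)
Lemma measure_zero_graph A (i : 'I_p) (y : 'rV[R]_p) (eta C : R) :
  0 < eta -> 0 <= C -> (forall z, A z -> cube eta (z - y)) ->
  (forall z z', A z -> A z' ->
    `|z 0 i - z' 0 i| <= C * \sum_(j < p | j != i) `|z 0 j - z' 0 j|) ->
  measure_zero A.
Proof.
move=> eta0 C0 Aeta Alip; apply: measure_zero_small => eps eps0.
pose L := C * p%:R.
have L0 : 0 <= L by rewrite mulr_ge0.
pose S := 2 * L * (2 * eta) * \prod_(j < p | j != i) (2 * eta).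
have S0 : 0 <= S.
  by rewrite !mulr_ge0 ?prodr_ge0// => [|*]; rewrite ?mulr_ge0 ?ltW.
pose n := Num.truncn (S / eps).
have nS : S / n.+1%:R <= eps.
  rewrite ler_pdivrMr// mulrC -ler_pdivrMr// ltW// truncnS_gt//.
pose w := 2 * eta / n.+1%:R.
have w0 : 0 <= w by rewrite divr_ge0// mulr_ge0 ?ltW.
have nw : n.+1%:R * w = 2 * eta by rewrite /w mulrC divfK.
pose cell (s : {ffun 'I_p -> 'I_n.+1}) (z : 'rV[R]_p) := forall j, j != i ->
  y 0 j - eta + (s j)%:R * w <= z 0 j <= y 0 j - eta + (s j).+1%:R * w.
(* In a cell that meets A a point of A is chosen as the centre; the box of an
   empty cell may be anywhere. *)
have /choice[pt ptP] : forall s, exists z0 : 'rV[R]_p,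
    forall z, A z -> cell s z -> A z0 /\ cell s z0.
  move=> s; have [[z [Az sz]]|nz] := pselect (exists z, A z /\ cell s z).
    by exists z.
  by exists 0 => z Az sz; exfalso; apply: nz; exists z.
(* The grid is indexed by all coordinates, but the boxes with a nonzero index
   in the coordinate i are flat: the total volume is then a sum over a full
   product, which factors. *)
pose lo (s : {ffun 'I_p -> 'I_n.+1}) : 'rV[R]_p := \row_j
  if j == i then pt s 0 i - (if s i == ord0 then L * w else 0)
  else y 0 j - eta + (s j)%:R * w.
pose hi (s : {ffun 'I_p -> 'I_n.+1}) : 'rV[R]_p := \row_j
  if j == i then pt s 0 i + (if s i == ord0 then L * w else 0)
  else y 0 j - eta + (s j).+1%:R * w.
pose v (j : 'I_p) (k : 'I_n.+1) : R :=
  if j == i then (if k == ord0 then 2 * (L * w) else 0) else w.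
have volE s : volume (lo s) (hi s) = \prod_j v j (s j).
  apply: eq_bigr => j _; rewrite !mxE /v.
  case: (j =P i) => [->|_]; first by case: ifP => _; ring.
  by rewrite -natr1; ring.
have Lw0 : 0 <= L * w by exact: mulr_ge0.
apply: (@le_trans _ _ (\esum_(s in [set: {ffun 'I_p -> 'I_n.+1}])
    (volume (lo s) (hi s))%:E)%E).
  apply: lebesgue_outer_cover => [s j|z Az].
    rewrite !mxE; case: ifP => _; first by case: ifP => _; lra.
    by rewrite lerD2l ler_wpM2r// ler_nat.
  have /choice[s sP] : forall j, exists k : 'I_n.+1,
      y 0 j - eta + k%:R * w <= z 0 j <= y 0 j - eta + k.+1%:R * w.
    move=> j; have := Aeta z Az j; rewrite !mxE ler_norml => /andP[? ?].
    have [|k] := @subdivision_cell w (z 0 j - (y 0 j - eta)) n w0.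
      by rewrite nw; apply/andP; split; lra.
    by move=> /andP[? ?]; exists k; apply/andP; split; lra.
  pose s' : {ffun 'I_p -> 'I_n.+1} := [ffun j => if j == i then ord0 else s j].
  have zs : cell s' z by move=> j /negbTE ji; rewrite /s' ffunE ji.
  have [Apt spt] := ptP s' z Az zs.
  exists s' => // j; rewrite !mxE.
  case: (j =P i) => [->|/eqP ji]; last exact: zs.
  have -> : s' i == ord0 by rewrite /s' ffunE eqxx.
  have : `|z 0 i - pt s' 0 i| <= L * w.
    apply: le_trans (Alip _ _ Az Apt) _; rewrite /L -mulrA ler_wpM2l//.
    apply: (@le_trans _ _ (\sum_(j < p | j != i) w)); last first.
      rewrite -[p in p%:R * w](card_ord p) -sum1_card natr_sum mulr_suml.
      rewrite big_mkcond/=; apply: ler_sum => k _.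
      by case: ifP; rewrite mul1r.
    apply: ler_sum => k ki; have /andP[] := zs k ki; have /andP[] := spt k ki.
    by rewrite -natr1 ler_norml => *; apply/andP; split; lra.
  by rewrite ler_norml => /andP[? ?]; apply/andP; split; lra.
rewrite [leLHS](@nsum_finType R _ (fun s => volume (lo s) (hi s))); last first.
  move=> s; rewrite volE prodr_ge0// => j _; rewrite /v.
  by case: ifP => // _; case: ifP => // _; rewrite mulr_ge0.
rewrite lee_fin (le_trans _ nS)//.
under eq_bigr do rewrite volE.
rewrite -bigA_distr_bigA (bigD1 i)//= [X in X * _](_ : _ = 2 * (L * w)); last first.
  rewrite (bigD1 ord0)//= /v !eqxx big1 ?addr0// => k /negbTE kn0.
  by rewrite kn0.
rewrite [X in _ * X](_ : _ = \prod_(j < p | j != i) (2 * eta)); last first.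
  apply: eq_bigr => j /negbTE ji; rewrite /v ji sumr_const card_ord -nw.
  by rewrite mulr_natl.
by rewrite /S /w !mulrA mulrAC.
Qed.

End NullSets.

(** * Formal derivatives and increments of power series *)

Section Increments.
Context {R : realType}.

Lemma power_increment (s v w : R) n : `|v| <= s -> `|w| <= s ->
  s * `|w ^+ n - v ^+ n| <= n%:R * s ^+ n * `|w - v|.
Proof.
move=> vs ws; have s0 : 0 <= s by exact: le_trans vs.
elim: n => [|n IHn]; first by rewrite !expr0 subrr normr0 mulr0 !mul0r.
have -> : w ^+ n.+1 - v ^+ n.+1 = w * (w ^+ n - v ^+ n) + v ^+ n * (w - v).
  by rewrite !exprS; ring.
apply: (@le_trans _ _ (s * (s * `|w ^+ n - v ^+ n|) + s * (s ^+ n * `|w - v|))).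
  rewrite -mulrDr ler_wpM2l// (le_trans (ler_normD _ _))// !normrM normrX lerD//.
    by rewrite ler_wpM2r.
  by rewrite ler_wpM2r// lerXn2r// nnegrE.
apply: (@le_trans _ _ (s * (n%:R * s ^+ n * `|w - v|) + s * (s ^+ n * `|w - v|))).
  by rewrite lerD2r ler_wpM2l.
by rewrite exprS -natr1; lra.
Qed.

(** The first order Taylor estimate of a monomial in one variable. The factor
    [s ^+ 2] on the left stands for [s ^+ (n - 2)] on the right: without truncated
    exponents the estimate goes through by induction on [n]. *)
Lemma power_taylor (s v w : R) n : `|v| <= s -> `|w| <= s ->
  s ^+ 2 * `|w ^+ n - v ^+ n - n%:R * v ^+ n.-1 * (w - v)| <=
  n%:R ^+ 2 * s ^+ n * `|w - v| ^+ 2.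
Proof.
move=> vs ws; have s0 : 0 <= s by exact: le_trans vs.
elim: n => [|n IHn].
  by rewrite !expr0 subrr !mul0r subrr normr0 mulr0 !expr2 !mul0r.
have -> : w ^+ n.+1 - v ^+ n.+1 - n.+1%:R * v ^+ n * (w - v) =
    v * (w ^+ n - v ^+ n - n%:R * v ^+ n.-1 * (w - v)) +
    (w - v) * (w ^+ n - v ^+ n).
  case: n {IHn} => [|n] /=; first by rewrite !expr0 expr1; ring.
  by rewrite -!natr1 !exprS; ring.
set E := _ - _ - _ in IHn *; have I := power_increment n vs ws.
apply: (@le_trans _ _ (s * (s ^+ 2 * `|E|) +
    s * `|w - v| * (s * `|w ^+ n - v ^+ n|))).
  rewrite [leRHS](_ : _ = s ^+ 2 * (s * `|E| + `|w - v| * `|w ^+ n - v ^+ n|)).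
    rewrite ler_wpM2l ?exprn_ge0// (le_trans (ler_normD _ _))// !normrM lerD2r.
    by rewrite ler_wpM2r.
  by ring.
apply: (@le_trans _ _ (s * (n%:R ^+ 2 * s ^+ n * `|w - v| ^+ 2) +
    s * `|w - v| * (n%:R * s ^+ n * `|w - v|))).
  by rewrite lerD// ler_wpM2l// mulr_ge0.
have n0 : 0 <= n%:R :> R by [].
have sn0 : 0 <= s ^+ n by rewrite exprn_ge0.
rewrite (exprS s n) -natr1; set d := `|w - v|.
rewrite [leLHS](_ : _ = (n%:R ^+ 2 + n%:R) * (s * s ^+ n * d ^+ 2)); last by ring.
rewrite [leRHS](_ : _ = (n%:R + 1) ^+ 2 * (s * s ^+ n * d ^+ 2)); last by ring.
apply: ler_wpM2r; first by apply: mulr_ge0; [exact: mulr_ge0|rewrite exprn_ge0 /d].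
rewrite -subr_ge0 [leRHS](_ : _ = n%:R + 1); last by ring.
by rewrite addr_ge0.
Qed.

Section FixedDimension.
Context {p : nat}.
Implicit Types (h z : 'rV[R]_p) (i j : 'I_p) (a : {ffun 'I_p -> nat})
  (c : {ffun 'I_p -> nat} -> R).

Definition set_coord h i (w : R) : 'rV[R]_p := \row_j if j == i then w else h 0 j.

Lemma cube_set_coord (s w : R) h i : `|w| <= s -> cube s h -> cube s (set_coord h i w).
Proof. by move=> ws hs j; rewrite mxE; case: ifP. Qed.

Definition unit_index i : {ffun 'I_p -> nat} := [ffun j => (j == i) : nat].

Lemma madd_unit_inj i : injective (fun a => madd a (unit_index i)).
Proof.
move=> a b /ffunP ab; apply/ffunP => j.
by have := ab j; rewrite !ffunE => /addIn.
Qed.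

Lemma mdeg_unit a i : mdeg (madd a (unit_index i)) = (mdeg a).+1.
Proof.
rewrite mdegD (_ : mdeg (unit_index i) = 1%N) ?addn1//.
rewrite /mdeg (bigD1 i)//= ffunE eqxx big1 ?addn0// => j /negbTE ji.
by rewrite ffunE ji.
Qed.

Lemma madd_unit_sub a i : (0 < a i)%N ->
  madd [ffun j => (a j - (j == i))%N] (unit_index i) = a.
Proof.
move=> ai; apply/ffunP => j; rewrite !ffunE subnK//.
by case: (j =P i) => [->|].
Qed.

(** The coefficients of the partial derivative along [i]. *)
Definition deriv_coef i c : {ffun 'I_p -> nat} -> R :=
  fun a => (a i).+1%:R * c (madd a (unit_index i)).

Lemma leq_mdeg a i : (a i <= mdeg a)%N.
Proof. by rewrite /mdeg (bigD1 i)//= leq_addr. Qed.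

(** Polynomial factors in the degree are absorbed by shrinking the radius: as
    [n <= 2 ^ n], the factor [n ^ 2] costs at most [4 ^ d]. Hence differentiated series
    still converge on the cube of a quarter of the radius. *)
Lemma quarter_weight (r : R) n d k : 0 < r -> (n <= d)%N -> (k <= 2)%N ->
  n%:R ^+ k * (r / 4) ^+ d <= r ^+ d.
Proof.
move=> r0 nd k2.
rewrite exprMn mulrCA; apply: ler_piMr; first by rewrite exprn_ge0// ltW.
rewrite exprVn ler_pdivrMr ?exprn_gt0//.
rewrite mul1r -!natrX ler_nat.
have nk : (n ^ k <= n ^ 2 + (n == 0))%N.
  by case: n nd => [|n] _; [case: k k2 => [|[|[|]]]|rewrite addn0 leq_pexp2l].
apply: (leq_trans nk); case: n nd {nk} => [|n] nd; first by rewrite expn_gt0.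
rewrite addn0 (_ : 4 = 2 ^ 2)%N// -expnM mulnC expnM leq_exp2r//.
by rewrite (leq_trans (ltnW (ltn_expl _ (ltnSn 1))))// leq_exp2l.
Qed.

Lemma monomial_set_coord h i w a : monomial (set_coord h i w) a =
  w ^+ a i * \prod_(j < p | j != i) h 0 j ^+ a j.
Proof.
rewrite /monomial (bigD1 i)//= mxE eqxx; congr (_ * _).
by apply: eq_bigr => j /negbTE ji; rewrite mxE ji.
Qed.

Lemma monomial_split h i a : monomial h a =
  h 0 i ^+ a i * \prod_(j < p | j != i) h 0 j ^+ a j.
Proof. by rewrite /monomial (bigD1 i). Qed.

Lemma monomial_rest_le (s : R) h i a : cube s h ->
  s ^+ a i * `|\prod_(j < p | j != i) h 0 j ^+ a j| <= s ^+ mdeg a.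
Proof.
move=> hs; have s0 : 0 <= s by exact: le_trans (hs i).
have -> : mdeg a = (a i + \sum_(j < p | j != i) a j)%N by rewrite /mdeg (bigD1 i).
rewrite exprD ler_wpM2l ?exprn_ge0//.
rewrite normr_prod -prodrXr; apply: ler_prod => j _.
by rewrite normr_ge0 normrX lerXn2r// nnegrE.
Qed.

Section Derivative.
Context (r M : R) (c : {ffun 'I_p -> nat} -> R).
Hypotheses (r_gt0 : 0 < r) (cM : (psnorm r c <= M%:E)%E).

Let s := r / 4.
Let s_gt0 : 0 < s. Proof. by rewrite /s divr_gt0. Qed.
Let s_le : s <= r. Proof. by rewrite /s; have := r_gt0; lra. Qed.

Let wgt_ge0 a : 0 <= `|c a| * r ^+ mdeg a.
Proof. by rewrite mulr_ge0// exprn_ge0// ltW. Qed.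

Let summ z : cube s z -> abs_summable (fun a => c a * monomial z a).
Proof.
move=> zs; apply: (psum_abs_summable (ltW s_gt0) zs).
by apply: le_lt_trans (psnorm_lt cM); apply: psnorm_le; rewrite (ltW s_gt0) s_le.
Qed.

Lemma psnorm_deriv i : (psnorm s (deriv_coef i c) <= (M / s)%:E)%E.
Proof.
pose u a := s^-1 * (`|c a| * r ^+ mdeg a).
have u0 a : 0 <= u a by rewrite mulr_ge0 ?invr_ge0 ?(ltW s_gt0)// wgt_ge0.
apply: (@le_trans _ _ (nsum u)); last first.
  rewrite nsumZ ?invr_ge0 ?(ltW s_gt0)//.
  by rewrite [M / s]mulrC EFinM; apply: lee_wpmul2l; rewrite ?lee_fin ?invr_ge0 ?(ltW s_gt0).
apply: le_trans (nsum_comp_inj (@madd_unit_inj i) u0); apply: le_nsum => a.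
rewrite /u /= /deriv_coef; set b := madd a _.
have bi : b i = (a i).+1 by rewrite /b !ffunE eqxx addn1.
have := quarter_weight (k := 1) r_gt0 (leq_mdeg b i) isT.
rewrite -/s expr1 normrM ger0_norm// bi [mdeg b]mdeg_unit => H.
rewrite ler_pdivlMl//.
rewrite [leLHS](_ : _ = `|c b| * ((a i).+1%:R * s ^+ (mdeg a).+1)).
  by rewrite ler_wpM2l.
by rewrite (exprS s (mdeg a)); ring.
Qed.

Let K1 := M / s.
Let K2 := M / s ^+ 2.

Lemma psum_lip_coord i w z : cube s z -> `|w| <= s ->
  `|psum c (set_coord z i w) - psum c z| <= K1 * `|w - z 0 i|.
Proof.
move=> zs ws; have us := cube_set_coord i ws zs.
rewrite /psum -asumB; [|exact: summ..]; apply: asum_norm_le.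
pose k := s^-1 * `|w - z 0 i|.
have k0 : 0 <= k by rewrite mulr_ge0// invr_ge0 ltW.
apply: (@le_trans _ _ (nsum (fun a => k * (`|c a| * r ^+ mdeg a)))).
  apply: le_nsum => a; rewrite -mulrBr normrM mulrCA ler_wpM2l//.
  rewrite monomial_set_coord (monomial_split z i) -mulrBl normrM /k.
  rewrite -mulrA ler_pdivlMl// mulrA.
  apply: (@le_trans _ _ ((a i)%:R * s ^+ a i * `|w - z 0 i| *
      `|\prod_(j < p | j != i) z 0 j ^+ a j|)).
    by rewrite ler_wpM2r//; exact: power_increment.
  rewrite (_ : _ * _ = `|w - z 0 i| * ((a i)%:R * (s ^+ a i *
      `|\prod_(j < p | j != i) z 0 j ^+ a j|))); last by ring.
  rewrite ler_wpM2l// (le_trans _ (quarter_weight (k := 1) r_gt0 (leq_mdeg a i) isT))//.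
  by rewrite expr1 ler_wpM2l// monomial_rest_le.
rewrite nsumZ//.
rewrite /K1 (_ : M / s * _ = k * M); last by rewrite /k; ring.
by rewrite [leRHS]EFinM; apply: lee_wpmul2l; rewrite ?lee_fin.
Qed.

Let rest z i a := \prod_(j < p | j != i) z 0 j ^+ a j.

(** The derivative of the term of index [madd a (unit_index i)] is the term of index
    [a] of the derivative series, and the terms free of the coordinate [i] have
    derivative 0. *)
Lemma psum_deriv i z : cube s z -> psum (deriv_coef i c) z =
  asum (fun a => c a * ((a i)%:R * z 0 i ^+ (a i).-1 * rest z i a)) /\
  abs_summable (fun a => c a * ((a i)%:R * z 0 i ^+ (a i).-1 * rest z i a)).
Proof.
move=> zs; set t := fun a => _.
have tE a : t (madd a (unit_index i)) = deriv_coef i c a * monomial z a.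
  rewrite /t /deriv_coef (monomial_split z i) /rest ffunE /unit_index ffunE eqxx.
  rewrite addn1 /= (_ : \prod_(j < p | j != i) _ = \prod_(j < p | j != i) z 0 j ^+ a j).
    by ring.
  by apply: eq_bigr => j /negbTE ji; rewrite !ffunE ji addn0.
have t0 b : (forall a, madd a (unit_index i) <> b) -> t b = 0.
  move=> nb; have [bi|bi] := posnP (b i); first by rewrite /t bi !mul0r mulr0.
  by have := nb _ (madd_unit_sub bi).
have st : abs_summable t.
  rewrite /abs_summable (nsum_inj (@madd_unit_inj i)); last first.
    by move=> b nb; rewrite t0// normr0.
  have := psum_abs_summable (ltW s_gt0) zs (psnorm_lt (psnorm_deriv i)).
  rewrite /abs_summable; congr (nsum _ < _)%E.
  by apply/funext => a /=; rewrite tE.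
split=> //; rewrite (asum_inj (@madd_unit_inj i) t0 st).
by congr asum; apply/funext => a /=; rewrite tE.
Qed.

(** The formal derivative controls the increments of the sum in the direction
    [i], at every point of the smaller cube and not only at the centre: this follows
    termwise from the estimate for monomials. *)
Lemma psum_taylor i w z : cube s z -> `|w| <= s ->
  `|psum c (set_coord z i w) - psum c z - psum (deriv_coef i c) z * (w - z 0 i)| <=
  K2 * `|w - z 0 i| ^+ 2.
Proof.
move=> zs ws; have us := cube_set_coord i ws zs.
have [-> st] := psum_deriv i zs.
rewrite mulrC -asumZ// /psum -asumB; [|exact: summ..].
have sB : abs_summable (fun a => c a * monomial (set_coord z i w) a - c a * monomial z a).
  have := abs_summableD (summ us) (abs_summableZ (-1) (summ zs)).
  by congr abs_summable; apply/funext => a; rewrite mulN1r.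
rewrite -asumB//; last exact: abs_summableZ.
apply: asum_norm_le; pose k := s^-1 ^+ 2 * `|w - z 0 i| ^+ 2.
have k0 : 0 <= k by rewrite mulr_ge0// exprn_ge0// invr_ge0 ltW.
apply: (@le_trans _ _ (nsum (fun a => k * (`|c a| * r ^+ mdeg a)))).
  apply: le_nsum => a.
  rewrite monomial_set_coord (monomial_split z i) -/(rest z i a).
  set v := z 0 i; set P := rest z i a; set n := a i.
  rewrite (_ : _ - _ = c a * ((w ^+ n - v ^+ n - n%:R * v ^+ n.-1 * (w - v)) * P));
    last by ring.
  rewrite normrM [leRHS]mulrCA ler_wpM2l// normrM /k exprVn -[leRHS]mulrA.
  rewrite ler_pdivlMl ?exprn_gt0// mulrA.
  apply: (@le_trans _ _ (n%:R ^+ 2 * s ^+ n * `|w - v| ^+ 2 * `|P|)).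
    by rewrite ler_wpM2r//; apply: power_taylor => //; exact: zs.
  rewrite (_ : _ * _ = `|w - v| ^+ 2 * (n%:R ^+ 2 * (s ^+ n * `|P|))); last by ring.
  rewrite ler_wpM2l ?exprn_ge0//.
  apply: le_trans (quarter_weight (k := 2) r_gt0 (leq_mdeg a i) isT).
  by rewrite ler_wpM2l ?exprn_ge0// monomial_rest_le.
rewrite nsumZ//.
rewrite /K2 (_ : M / s ^+ 2 * _ = k * M); last by rewrite /k exprVn; ring.
by rewrite [leRHS]EFinM; apply: lee_wpmul2l; rewrite ?lee_fin.
Qed.

End Derivative.

(** The coordinates of [z] are replaced by those of [z'] one after the other. *)
Lemma lipschitz_of_coord (f : 'rV[R]_p -> R) (s K : R) :
  (forall i w z, cube s z -> `|w| <= s ->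
     `|f (set_coord z i w) - f z| <= K * `|w - z 0 i|) ->
  forall z z', cube s z -> cube s z' ->
    `|f z' - f z| <= K * \sum_j `|z' 0 j - z 0 j|.
Proof.
move=> fK z z' zs z's.
pose y n : 'rV[R]_p := \row_j if (j < n)%N then z' 0 j else z 0 j.
have ys n : cube s (y n) by move=> j; rewrite mxE; case: ifP.
have step n : (n <= p)%N ->
    `|f (y n) - f z| <= K * \sum_(j < p | (j < n)%N) `|z' 0 j - z 0 j|.
  elim: n => [|n IHn] np.
    rewrite (_ : y 0%N = z); last by apply/rowP => j; rewrite mxE.
    by rewrite subrr normr0 big1 ?mulr0// => j; rewrite ltn0.
  pose i := Ordinal np.
  have yE : y n.+1 = set_coord (y n) i (z' 0 i).
    apply/rowP => j; rewrite !mxE ltnS leq_eqVlt.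
    rewrite -[(j : nat) == n]/(j == i); case: eqP => [->|//].
    by [].
  rewrite (bigD1 i)//= mulrDr.
  have -> : f (y n.+1) - f z = (f (y n.+1) - f (y n)) + (f (y n) - f z) by ring.
  rewrite (le_trans (ler_normD _ _))// lerD//.
    rewrite yE (le_trans (fK _ _ _ (ys n) (z's i)))//.
    by rewrite mxE /= ltnn.
  rewrite (le_trans (IHn (ltnW np)))//.
  rewrite [leRHS](_ : _ = K * \sum_(j < p | (j < n)%N) `|z' 0 j - z 0 j|)//.
  congr (_ * _); apply: eq_bigl => j; rewrite ltnS.
  by rewrite [RHS]ltn_neqAle andbC.
rewrite (_ : z' = y p).
  apply: le_trans (step p (leqnn p)) _; rewrite le_eqVlt; apply/orP; left.
  apply/eqP; congr (_ * _); apply: eq_big => [j|j _]; first by rewrite ltn_ord.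
  by rewrite mxE ltn_ord.
by apply/rowP => j; rewrite mxE ltn_ord.
Qed.

End FixedDimension.
End Increments.

(** * Zero sets of power series *)

Section ZeroSets.
Context {R : realType} {p : nat}.
Implicit Types (h z : 'rV[R]_p) (i j : 'I_p) (a : {ffun 'I_p -> nat})
  (c : {ffun 'I_p -> nat} -> R).

Lemma sum_norm_le (d : 'rV[R]_p) (e : R) : cube e d ->
  \sum_j `|d 0 j| <= p%:R * e.
Proof.
move=> de; apply: (@le_trans _ _ (\sum_(j < p) e)); first exact: ler_sum.
by rewrite sumr_const card_ord mulr_natl.
Qed.

(** Where [g], the derivative of [f] along [i], does not vanish, the zero set of
    [f] is locally a Lipschitz graph. For two zeros [z] and [z'] near such a point, move
    the coordinate [i] of [z] to that of [z']: [f] changes by about [g z] times the move,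
    and its value after the move is bounded by the distance of the other
    coordinates, as [f] vanishes at [z']. *)
Lemma measure_zero_transversal (f g : 'rV[R]_p -> R) i (s K : R) : 0 < s -> 0 <= K ->
  (forall j w z, cube s z -> `|w| <= s ->
     `|f (set_coord z j w) - f z| <= K * `|w - z 0 j|) ->
  (forall j w z, cube s z -> `|w| <= s ->
     `|g (set_coord z j w) - g z| <= K * `|w - z 0 j|) ->
  (forall w z, cube s z -> `|w| <= s ->
     `|f (set_coord z i w) - f z - g z * (w - z 0 i)| <= K * `|w - z 0 i| ^+ 2) ->
  measure_zero [set z | [/\ cube s z, f z = 0 & g z != 0]].
Proof.
move=> s0 K0 fK gK fgK.
have flip := lipschitz_of_coord fK; have glip := lipschitz_of_coord gK.
apply: measure_zero_local => y [ys fy gy].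
pose G := `|g y|; have G0 : 0 < G by rewrite normr_gt0.
have p0 : 0 <= p%:R :> R by [].
have K1 : 0 < K + 1 by lra.
have p1 : 0 < p%:R + 1 :> R by lra.
(* On the cube of radius eta around y, g varies by at most G / 8, and the
   quadratic error K d ^ 2 is at most G / 4 * d. *)
pose eta := G / (8 * (K + 1) * (p%:R + 1)).
have eta0 : 0 < eta by rewrite divr_gt0// !mulr_gt0.
have etaE : eta * (8 * (K + 1) * (p%:R + 1)) = G.
  by rewrite /eta divfK// gt_eqF// !mulr_gt0.
have Keta0 : 0 <= K * eta by rewrite mulr_ge0// ltW.
have KpG : K * (p%:R * eta) <= G / 8.
  rewrite -etaE; have : 0 <= eta * (K + p%:R + 1).
    by rewrite mulr_ge0 ?(ltW eta0)// !addr_ge0.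
  move: (p%:R) p0 => P P0; nra.
have KG : K * eta <= G / 8.
  rewrite -etaE; have : 0 <= eta * (K * p%:R + p%:R + 1).
    by rewrite mulr_ge0 ?(ltW eta0)// !addr_ge0// mulr_ge0.
  move: (p%:R) p0 => P P0; nra.
exists eta => //; apply: (@measure_zero_graph _ _ _ i y eta (4 * K / G)) => //.
- by rewrite divr_ge0 ?(ltW G0)// mulr_ge0.
- by move=> z [].
move=> z' z [[z's fz' _] z'y] [[zs fz _] zy].
have gz : G / 2 <= `|g z|.
  have gyz : `|g y - g z| <= G / 8.
    apply: le_trans KpG; apply: le_trans (glip _ _ zs ys) _.
    apply: ler_wpM2l => //.
    rewrite (eq_bigr (fun j => `|(z - y) 0 j|)) ?sum_norm_le// => j _.
    by rewrite !mxE distrC.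
  have := lerB_dist (g y) (g y - g z); rewrite subKr -/G; lra.
set d := `|_ - _|; set S := \sum_(j | _) _.
have d0 : 0 <= d by exact: normr_ge0.
have dz : d <= 2 * eta.
  have := z'y i; have := zy i; rewrite !mxE /d => h1 h2.
  have -> : z' 0 i - z 0 i = (z' 0 i - y 0 i) - (z 0 i - y 0 i) by ring.
  by rewrite (le_trans (ler_normB _ _))//; lra.
have fu : `|f (set_coord z i (z' 0 i))| <= K * S.
  have := flip z' _ z's (cube_set_coord i (z's i) zs); rewrite fz' subr0 => /le_trans; apply.
  rewrite ler_wpM2l// (bigD1 i)//= mxE eqxx subrr normr0 add0r.
  rewrite le_eqVlt; apply/orP; left; apply/eqP; apply: eq_bigr => j /negbTE ji.
  by rewrite mxE ji distrC.
have := fgK _ _ zs (z's i); rewrite fz subr0 -/d => fg.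
have gd : `|g z| * d <= K * S + K * d ^+ 2.
  rewrite -normrM.
  have := lerB_dist (g z * (z' 0 i - z 0 i)) (f (set_coord z i (z' 0 i))).
  rewrite distrC; lra.
have Kd2 : K * d ^+ 2 <= G / 4 * d.
  rewrite expr2 mulrA ler_wpM2r//.
  by apply: (@le_trans _ _ (K * (2 * eta))); [exact: ler_wpM2l|lra].
have Gd : G / 2 * d <= `|g z| * d by rewrite ler_wpM2r.
by rewrite mulrAC ler_pdivlMr//; lra.
Qed.

(** The zero set of a nonzero power series is null near the centre. By induction
    on the degree of a multi-index [a] with [c a != 0]: in degree 0 the sum is nonzero
    near the centre by continuity; otherwise some derivative has a nonzero
    coefficient of smaller degree, its zero set is null, and the zeros of the series
    outside it form a null set by the transversal case. *)
Lemma zero_set_measure_zero (r M : R) c a : 0 < r ->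
  (psnorm r c <= M%:E)%E -> c a != 0 ->
  exists2 s, 0 < s & measure_zero [set h | cube s h /\ psum c h = 0].
Proof.
move En : (mdeg a) => n; elim: n r M c a En => [|n IHn] r M c a an r0 cM ca.
- have r4 : 0 < r / 4 by rewrite divr_gt0.
  have M0 : 0 <= M.
    rewrite -lee_fin (le_trans _ cM)// nsum_ge0// => b.
    by rewrite mulr_ge0// exprn_ge0// ltW.
  have lip := lipschitz_of_coord (fun i w z => @psum_lip_coord _ _ r M c r0 cM i w z).
  have ca0 : psum c 0 = c a by rewrite psum0; congr c; apply/esym/eqP; rewrite -mdeg_eq0 an.
  pose K := M / (r / 4); have K0 : 0 <= K by rewrite divr_ge0// ltW.
  (* On the cube of radius e the sum differs from c a by at most half of it. *)
  pose e := Num.min (r / 4) (`|c a| / (2 * (K + 1) * (p%:R + 1))).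
  have Kp0 : 0 < 2 * (K + 1) * (p%:R + 1).
    by rewrite !mulr_gt0// ltr_wpDl.
  have e0 : 0 < e by rewrite lt_min r4 divr_gt0// normr_gt0.
  have eca : e * (2 * (K + 1) * (p%:R + 1)) <= `|c a|.
    by rewrite -ler_pdivlMr// ge_min lexx orbT.
  exists e => //; apply: measure_zero_sub measure_zero_set0 => h [he ch].
  have hr : cube (r / 4) h by apply: cube_le he; rewrite ge_min lexx.
  have := lip 0 h (@cube0 _ _ _ (ltW r4)) hr; rewrite ch ca0 sub0r normrN -/K.
  rewrite (eq_bigr (fun j => `|h 0 j|)) => [|j _]; last by rewrite mxE subr0.
  have := ler_wpM2l K0 (sum_norm_le he).
  have ca1 : 0 < `|c a| by rewrite normr_gt0.
  have p0 : 0 <= p%:R :> R by [].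
  have t1 : 0 <= e * (K * p%:R) by rewrite mulr_ge0 ?(ltW e0)// mulr_ge0.
  have t2 : 0 <= e * (K + p%:R + 1) by rewrite mulr_ge0 ?(ltW e0)// !addr_ge0.
  move: (p%:R) p0 t1 t2 eca => P P0 t1 t2 eca; nra.
- have [i ai] : exists i, (0 < a i)%N.
    apply/existsP; apply: contraT; rewrite negb_exists => /forallP az.
    suff /eqP : mdeg a == 0%N by rewrite an.
    rewrite mdeg_eq0; apply/eqP/ffunP => i; rewrite ffunE.
    by have := az i; rewrite -eqn0Ngt => /eqP.
  pose b : {ffun 'I_p -> nat} := [ffun j => (a j - (j == i))%N].
  have ab : madd b (unit_index i) = a by exact: madd_unit_sub.
  have bn : mdeg b = n by have := mdeg_unit b i; rewrite ab an => -[].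
  have r4 : 0 < r / 4 by rewrite divr_gt0.
  have r16 : 0 < r / 4 / 4 by rewrite divr_gt0.
  have dM := psnorm_deriv r0 cM i.
  have cb : deriv_coef i c b != 0 by rewrite /deriv_coef ab mulf_neq0// pnatr_eq0.
  have [s s0 sz] := IHn _ _ _ _ bn r4 dM cb.
  have M0 : 0 <= M.
    rewrite -lee_fin (le_trans _ cM)// nsum_ge0// => d.
    by rewrite mulr_ge0// exprn_ge0// ltW.
  pose K1 := M / (r / 4); pose K2 := M / (r / 4) ^+ 2; pose K3 := K1 / (r / 4 / 4).
  have K10 : 0 <= K1 by rewrite divr_ge0// ltW.
  have K20 : 0 <= K2 by rewrite divr_ge0// exprn_ge0// ltW.
  have K30 : 0 <= K3 by rewrite divr_ge0// ltW.
  have le4 (z : 'rV[R]_p) : cube (r / 4 / 4) z -> cube (r / 4) z.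
    by apply: cube_le; lra.
  have le4' (w : R) : `|w| <= r / 4 / 4 -> `|w| <= r / 4 by lra.
  (* The derivative lives on the cube of radius r / 4, hence its increments are
     controlled on that of radius r / 16. *)
  have tr : measure_zero [set z | [/\ cube (r / 4 / 4) z, psum c z = 0 &
      psum (deriv_coef i c) z != 0]].
    apply: (@measure_zero_transversal _ _ i _ (K1 + K2 + K3) r16)
      => [|j w z zs ws|j w z zs ws|w z zs ws].
    - by rewrite !addr_ge0.
    - apply: le_trans (psum_lip_coord r0 cM j (le4 _ zs) (le4' _ ws)) _.
      by rewrite ler_wpM2r// -/K1; lra.
    - apply: le_trans (psum_lip_coord r4 dM j zs ws) _.
      by rewrite ler_wpM2r// -/K1 -/K3; lra.
    - apply: le_trans (psum_taylor r0 cM i (le4 _ zs) (le4' _ ws)) _.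
      by rewrite ler_wpM2r ?exprn_ge0// -/K2; lra.
  exists (Num.min s (r / 4 / 4)); first by rewrite lt_min s0.
  apply: measure_zero_sub (measure_zeroU sz tr) => h [hm ch].
  have [d0|d0] := eqVneq (psum (deriv_coef i c) h) 0; [left|right].
    by split=> //; apply: cube_le hm; rewrite ge_min lexx.
  by split=> //; apply: cube_le hm; rewrite ge_min lexx orbT.
Qed.

Lemma analytic_at_lip (f : 'rV[R]_p -> R) (x : 'rV[R]_p) : analytic_at f x ->
  exists s K : R, [/\ 0 < s, 0 <= K &
    forall h, cube s h -> `|f (x + h) - f x| <= K * \sum_j `|h 0 j|].
Proof.
move=> /analytic_atP[r [M [r0 ef]]]; have M0 := expands_ge0 (ltW r0) ef.
case: ef => [c [cM fc]]; have r4 : 0 < r / 4 by rewrite divr_gt0.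
exists (r / 4), (M / (r / 4)); split=> //; first by rewrite divr_ge0// ltW.
move=> h hr; have hr' : cube r h by apply: cube_le hr; lra.
have lip := lipschitz_of_coord (fun i w z => @psum_lip_coord _ _ r M c r0 cM i w z).
have := lip 0 h (@cube0 _ _ _ (ltW r4)) hr.
rewrite -!fc ?addr0//; last exact/cube0/ltW.
by rewrite (eq_bigr (fun j => `|h 0 j|)) => [|j _]; rewrite ?mxE ?subr0.
Qed.

(** The local form of the identity principle: near [x] the function is constantly
    equal to [k], or takes this value on a null set only, according to whether the
    coefficients of the expansion of [f - k] all vanish. *)
Lemma level_set_dichotomy (f : 'rV[R]_p -> R) (x : 'rV[R]_p) (k : R) :
  analytic_at f x -> exists2 s : R, 0 < s &
    (forall h, cube s h -> f (x + h) = k) \/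
    measure_zero [set y | cube s (y - x) /\ f y = k].
Proof.
move=> /analytic_atP[r [M [r0 ef]]].
have [c [cM fc]] := expandsD r0 ef (expands_cst (- k) (ltW r0)).
have [c0|] := pselect (forall a, c a = 0).
  exists r => //; left => h hr; apply/eqP; rewrite -subr_eq0 fc//.
  have cz a : a != [ffun=> 0%N] -> c a * monomial h a = 0 by rewrite c0 mul0r.
  by apply/eqP; rewrite /psum (asum_single cz).2 c0 mul0r.
move=> /existsNP[a /eqP ca].
have [s s0 sz] := zero_set_measure_zero r0 cM ca.
exists (Num.min s r); first by rewrite lt_min s0.
right; apply: measure_zero_sub (measure_zero_translate x sz) => y [ys fy] /=.
split; first by apply: cube_le ys; rewrite ge_min lexx.
have yr : cube r (y - x) by apply: cube_le ys; rewrite ge_min lexx orbT.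
by rewrite -(fc _ yr) [x + _]addrC subrK fy subrr.
Qed.

End ZeroSets.

(** * Functions analytic almost everywhere *)

Section AlmostEverywhereAnalytic.
Context {R : realType} {p : nat}.
Implicit Types (f g : 'rV[R]_p -> R) (x : 'rV[R]_p) (A : set 'rV[R]_p).

Lemma nbhs_cube x A : nbhs x A <->
  exists2 r : R, 0 < r & forall h, cube r h -> A (x + h).
Proof.
split=> [/nbhs_ballP[e /= e0 xA]|[r r0 rA]].
  exists (e / 2) => [|h he]; first by rewrite divr_gt0.
  apply: xA; split=> // i j; rewrite (ord1 i) /ball/= mxE opprD addNKr normrN.
  by rewrite (le_lt_trans (he j))//; lra.
apply/nbhs_ballP; exists r => // y [_ yr].
rewrite -(subrK x y) addrC; apply: rA => j.
by have := ltW (yr 0 j); rewrite !mxE distrC.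
Qed.

Lemma analytic_at_nbhs f g x : (\forall y \near x, f y = g y) ->
  analytic_at f x -> analytic_at g x.
Proof. by move=> /nbhs_cube[r r0 fg]; exact: analytic_at_local r0 fg. Qed.

Lemma analytic_at_continuous f x (e : R) : analytic_at f x -> 0 < e ->
  \forall y \near x, `|f y - f x| < e.
Proof.
move=> /analytic_at_lip[s [K [s0 K0 fK]]] e0.
have D0 : 0 < 2 * (K + 1) * (p%:R + 1) by rewrite !mulr_gt0 ?ltr_wpDl.
(* The variation is at most K * p * r on the cube of radius r. *)
pose r := Num.min s (e / (2 * (K + 1) * (p%:R + 1))).
have r0 : 0 < r by rewrite lt_min s0 divr_gt0.
have rD : r * (2 * (K + 1) * (p%:R + 1)) <= e.
  by rewrite -ler_pdivlMr// ge_min lexx orbT.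
apply/nbhs_cube; exists r => // h hr.
apply: le_lt_trans (fK h _) _; first by apply: cube_le hr; rewrite ge_min lexx.
have := ler_wpM2l K0 (sum_norm_le hr).
have p0 : 0 <= p%:R :> R by [].
have t1 : 0 <= r * (K * p%:R) by rewrite mulr_ge0 ?(ltW r0)// mulr_ge0.
have t2 : 0 <= r * (K + p%:R + 1) by rewrite mulr_ge0 ?(ltW r0)// !addr_ge0.
move: (p%:R) p0 t1 t2 rD => P P0 t1 t2 rD; nra.
Qed.

(** Finitely many almost everywhere analytic functions are simultaneously
    analytic on a conull open set, so that pointwise closure properties pass to
    almost everywhere analyticity. *)
Lemma ae_analytic_lift (I : finType) (F : I -> 'rV[R]_p -> R) f :
  (forall i, ae_analytic (F i)) ->
  (forall x, (forall i, analytic_at (F i) x) -> analytic_at f x) ->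
  ae_analytic f.
Proof.
move=> /choice[U UP] Ff; exists (\bigcap_i U i)°; split.
- exact: open_interior.
- apply: (@measure_zero_sub _ _ _ (\bigcup_(i in [set: I]) ~` U i)); last first.
    by apply: measure_zero_countable => i _; have [] := UP i.
  move=> x nx; apply: contrapT => nU; apply: nx.
  have Ux i : U i x by apply: contrapT => nUx; apply: nU; exists i.
  have : \forall y \near x, forall i, U i y.
    apply: (@filter_forall _ I U (nbhs x)) => i; have [+ _ _] := UP i.
    by rewrite openE => /(_ _ (Ux i)).
  by apply: filterS => y yU i _.
- move=> x /interior_subset xU; apply: Ff => i.
  by have [_ _] := UP i; apply; exact: xU.
Qed.

Lemma ae_analytic_everywhere f : (forall x, analytic_at f x) -> ae_analytic f.
Proof.
move=> af; apply: (@ae_analytic_lift void (fun _ _ => 0)) => // -[].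
Qed.

Lemma ae_analytic_cst (k : R) : ae_analytic (fun _ : 'rV[R]_p => k).
Proof. by apply: ae_analytic_everywhere => x; exact: analytic_at_cst. Qed.

Lemma ae_analyticM f g : ae_analytic f -> ae_analytic g ->
  ae_analytic (fun x => f x * g x).
Proof.
move=> af ag; apply: (@ae_analytic_lift bool (fun b => if b then f else g)).
  by case.
by move=> x afg; apply: analytic_atM; [exact: (afg true)|exact: (afg false)].
Qed.

Lemma ae_analytic_sum (I : finType) (F : I -> 'rV[R]_p -> R) :
  (forall i, ae_analytic (F i)) -> ae_analytic (fun x => \sum_i F i x).
Proof. by move=> aF; apply: (ae_analytic_lift aF) => x; exact: analytic_at_sum. Qed.

Lemma ae_analytic_comp q (g : 'rV[R]_q -> R) (F : 'rV[R]_p -> 'rV[R]_q) :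
  (forall x, analytic_at g (F x)) -> (forall j, ae_analytic (fun x => F x 0 j)) ->
  ae_analytic (fun x => g (F x)).
Proof.
by move=> ag aF; apply: (ae_analytic_lift aF) => x; exact: analytic_at_comp.
Qed.

Lemma ae_analytic_comp1 (phi : R -> R) f :
  (forall x, analytic_at (fun v : 'rV[R]_1 => phi (v 0 0)) (const_mx (f x))) ->
  ae_analytic f -> ae_analytic (fun x => phi (f x)).
Proof.
move=> aphi af.
rewrite (_ : (fun x => _) =
    (fun x => (fun v : 'rV[R]_1 => phi (v 0 0)) (const_mx (f x)))).
  apply: (@ae_analytic_comp 1 (fun v => phi (v 0 0)) (fun x => const_mx (f x))) => // j.
  by rewrite (_ : (fun x => _) = f)//; apply/funext => x; rewrite mxE.
by apply/funext => x; rewrite mxE.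
Qed.

(** A finite induction from a breakpoint below [t] up to one above [t]. *)
Lemma breakpoint_interval (b : int -> R) (t : R) :
  (forall i j : int, i < j -> b i < b j) ->
  (fun n : nat => b n%:Z) @ \oo --> +oo ->
  (fun n : nat => b (- n%:Z)) @ \oo --> -oo ->
  exists i : int, b i <= t < b (i + 1).
Proof.
move=> bmono /cvgryPge/(_ (t + 1))[m _ /(_ m (leqnn m)) /= mt].
move=> /cvgrNyPle/(_ t)[n _ /(_ n (leqnn n)) /= nt].
have : t < b (- n%:Z + (m + n)%:Z).
  by rewrite (_ : - n%:Z + (m + n)%:Z = m%:Z); [lra|lia].
elim: (m + n)%N => [|k IHk]; first by rewrite addr0; lra.
have [tk _|tk tk1] := ltP t (b (- n%:Z + k%:Z)); first exact: IHk.
exists (- n%:Z + k%:Z); rewrite tk/= (_ : _ + 1 = - n%:Z + k.+1%:Z)//; lia.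
Qed.

(** The composition is analytic at the points where [f] is analytic and avoids
    the breakpoints, and at those around which [f] is constantly equal to a
    breakpoint. At the remaining points [f] equals a breakpoint without being locally
    constant; near each of them the corresponding level set is null, and there are
    countably many breakpoints. *)
Lemma ae_analytic_piecewise (sigma : R -> R) f : piecewise_analytic sigma ->
  ae_analytic f -> ae_analytic (fun x => sigma (f x)).
Proof.
move=> [b [bmono bpos bneg bana]] [U [Uo U0 fana]].
(* Taking the interior makes this part of the domain open. *)
pose flat i := [set x | f x = b i]°.
pose reg i := [set x | U x /\ b i < f x < b (i + 1)].
exists ((\bigcup_i reg i) `|` (\bigcup_i (U `&` flat i))); split.
- apply: openU; apply: bigcup_open => i _.
    rewrite openE => x [Ux /andP[b1 b2]].
    have e0 : 0 < Num.min (f x - b i) (b (i + 1) - f x) by rewrite lt_min; lra.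
    have fx := analytic_at_continuous (fana x Ux) e0.
    have Unx : \forall y \near x, U y by move: Uo; rewrite openE; apply.
    apply: filterS2 fx Unx => y; rewrite lt_min => /andP[y1 y2] Uy; split=> //.
    by move: y1 y2; rewrite !ltr_norml; lra.
  by apply: openI => //; exact: open_interior.
- apply: (@measure_zero_sub _ _ _ (~` U `|` \bigcup_(i in [set: int])
      [set x | U x /\ f x = b i /\ ~ flat i x])).
    move=> x nx; have [Ux|nUx] := pselect (U x); last by left.
    right; have [i /andP[b1 b2]] := breakpoint_interval (f x) bmono bpos bneg.
    exists i => //; split=> //.
    have [fb|fb] := eqVneq (f x) (b i).
      by split=> // fl; apply: nx; right; exists i.
    exfalso; apply: nx; left; exists i => //; split=> //.
    by rewrite b2 andbT lt_neqAle eq_sym fb.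
  apply: measure_zeroU => //; apply: measure_zero_countable => i _.
  apply: measure_zero_local => x [Ux [fx nfl]].
  have [s s0 [fs|fs]] := level_set_dichotomy (b i) (fana x Ux).
    by exfalso; apply: nfl; apply/nbhs_cube; exists s.
  by exists s => //; apply: measure_zero_sub fs => y [[_ [fy _]] ys].
- move=> x [[i _ [Ux fx]]|[i _ [Ux fl]]].
    rewrite (_ : (fun x => _) =
      (fun x => (fun v : 'rV[R]_1 => sigma (v 0 0)) (const_mx (f x)))); last first.
      by apply/funext => y; rewrite mxE.
    apply: (@analytic_at_comp _ _ 1 (fun v => sigma (v 0 0)) (fun x => const_mx (f x))).
      by apply: (bana i); rewrite /= mxE.
    move=> j; rewrite (_ : (fun x => _) = f); first exact: fana.
    by apply/funext => y; rewrite mxE.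
  apply: (@analytic_at_nbhs (fun=> sigma (b i))); last exact: analytic_at_cst.
  by apply: filterS fl => y ->.
Qed.

End AlmostEverywhereAnalytic.

(** * Layers and networks *)

Section Networks.
Context {R : realType} {p : nat}.

Lemma dense_ae_analytic nin nout (sigma : R -> R)
    (W : 'rV[R]_p -> 'M[R]_(nout, nin)) (z : 'rV[R]_p -> 'rV[R]_nin) :
  piecewise_analytic sigma -> (forall i j, ae_analytic (fun t => W t i j)) ->
  (forall j, ae_analytic (fun t => z t 0 j)) ->
  forall i, ae_analytic (fun t => dense sigma (W t) (z t) 0 i).
Proof.
move=> hsigma hW hz i.
rewrite (_ : (fun t => _) = (fun t => sigma (\sum_j W t i j * z t 0 j))).
  apply: ae_analytic_piecewise => //; apply: ae_analytic_sum => j.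
  exact: ae_analyticM.
by apply/funext => t; rewrite !mxE; congr sigma; apply: eq_bigr => j _; rewrite mxE.
Qed.

Lemma mulmx_ae_analytic m n k (A : 'rV[R]_p -> 'M[R]_(m, n))
    (B : 'rV[R]_p -> 'M[R]_(n, k)) :
  (forall i j, ae_analytic (fun t => A t i j)) ->
  (forall i j, ae_analytic (fun t => B t i j)) ->
  forall i j, ae_analytic (fun t => (A t *m B t) i j).
Proof.
move=> hA hB i j.
rewrite (_ : (fun t => _) = (fun t => \sum_l A t i l * B t l j)).
  by apply: ae_analytic_sum => l; exact: ae_analyticM.
by apply/funext => t; rewrite mxE.
Qed.

Lemma softmax_ae_analytic m n (A : 'rV[R]_p -> 'M[R]_(m, n)) :
  (forall i j, ae_analytic (fun t => A t i j)) ->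
  forall i j, ae_analytic (fun t => softmax_rows (A t) i j).
Proof.
move=> hA i j.
have hE k : ae_analytic (fun t => expR (A t i k)).
  by apply: ae_analytic_comp1 => // t; exact: analytic_at_expR.
rewrite (_ : (fun t => _) =
    (fun t => expR (A t i j) * (\sum_k expR (A t i k))^-1)).
  apply: ae_analyticM => //; apply: ae_analytic_comp1 => [t|]; last exact: ae_analytic_sum.
  apply: analytic_at_inv; rewrite mxE gt_eqF// (bigD1 j)//= ltr_pwDl ?expR_gt0//.
  by apply: sumr_ge0 => k _; exact: expR_ge0.
by apply/funext => t; rewrite mxE.
Qed.

Lemma attention_ae_analytic n d h (Wq Wk Wv : 'rV[R]_p -> 'M[R]_(h, d))
    (X : 'rV[R]_p -> 'M[R]_(d, n)) :
  (forall i j, ae_analytic (fun t => Wq t i j)) ->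
  (forall i j, ae_analytic (fun t => Wk t i j)) ->
  (forall i j, ae_analytic (fun t => Wv t i j)) ->
  (forall i j, ae_analytic (fun t => X t i j)) ->
  forall i j, ae_analytic (fun t => attention (Wq t) (Wk t) (Wv t) (X t) i j).
Proof.
move=> hq hk hv hX; apply: mulmx_ae_analytic; last exact: mulmx_ae_analytic.
apply: softmax_ae_analytic => i j.
rewrite (_ : (fun t => _) = (fun t => (Num.sqrt n%:R)^-1 *
    ((Wq t *m X t) *m (Wk t *m X t)^T) i j)); last first.
  by apply/funext => t; rewrite mxE.
apply: ae_analyticM; first exact: ae_analytic_cst.
apply: mulmx_ae_analytic => [|k l]; first exact: mulmx_ae_analytic.
rewrite (_ : (fun t => _) = (fun t => (Wk t *m X t) l k)).
  exact: mulmx_ae_analytic.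
by apply/funext => t; rewrite mxE.
Qed.

(** Slices and reshapings of the parameter vector, and shared weights, only
    select entries. *)
Lemma reindex_ae_analytic m n m' n' (A : 'rV[R]_p -> 'M[R]_(m, n))
    (B : 'rV[R]_p -> 'M[R]_(m', n')) (e : 'I_m -> 'I_n -> 'I_m')
    (e' : 'I_m -> 'I_n -> 'I_n') :
  (forall t i j, A t i j = B t (e i j) (e' i j)) ->
  (forall i j, ae_analytic (fun t => B t i j)) ->
  forall i j, ae_analytic (fun t => A t i j).
Proof.
move=> AB hB i j.
by rewrite (_ : (fun t => _) = (fun t => B t (e i j) (e' i j)))//; apply/funext.
Qed.

Lemma layer_ae_analytic nin nout (l : layer nin nout)
    (w : 'rV[R]_p -> 'rV[R]_(layer_nparams l)) (z : 'rV[R]_p -> 'rV[R]_nin) :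
  layer_piecewise_analytic l ->
  (forall i j, ae_analytic (fun t => w t i j)) ->
  (forall i j, ae_analytic (fun t => z t i j)) ->
  forall i j, ae_analytic (fun t => layer_eval (w t) (z t) i j).
Proof.
case: l w => [sigma|k tie tie_surj sigma|n d h n0 eq_in eq_out] /= w hl hw hz i j.
- rewrite (ord1 i); apply: dense_ae_analytic => //.
  exact: (reindex_ae_analytic (e := fun _ _ => 0) (fun t i j => mxE _ _ _ _)).
- rewrite (ord1 i); apply: dense_ae_analytic => //.
  exact: (reindex_ae_analytic (e := fun _ _ => 0) (fun t i j => mxE _ _ _ _)).
- subst nin nout; rewrite /= (ord1 i).
  case/mxvec_indexP: j => a b.
  pose W1 t : 'M[R]_(h, d) := vec_mx (lsubmx (w t)).
  pose W2 t : 'M[R]_(h, d) := vec_mx (lsubmx (rsubmx (w t))).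
  pose W3 t : 'M[R]_(h, d) := vec_mx (rsubmx (rsubmx (w t))).
  pose X t : 'M[R]_(d, n) := (vec_mx (z t))^T.
  rewrite (_ : (fun t => _) = (fun t => attention (W1 t) (W2 t) (W3 t) (X t) b a)).
    apply: attention_ae_analytic.
    + apply: (reindex_ae_analytic (B := w) (e := fun _ _ => 0)
        (e' := fun i j => lshift _ (mxvec_index i j))) => // t k l.
      by rewrite !mxE.
    + apply: (reindex_ae_analytic (B := w) (e := fun _ _ => 0)
        (e' := fun i j => rshift _ (lshift _ (mxvec_index i j)))) => // t k l.
      by rewrite !mxE.
    + apply: (reindex_ae_analytic (B := w) (e := fun _ _ => 0)
        (e' := fun i j => rshift _ (rshift _ (mxvec_index i j)))) => // t k l.
      by rewrite !mxE.
    + apply: (reindex_ae_analytic (B := z) (e := fun _ _ => 0)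
        (e' := fun i j => mxvec_index j i)) => // t k l.
      by rewrite !mxE.
  by apply/funext => t; rewrite /= !castmx_id /attention_vec mxvecE mxE.
Qed.

(** The parameters are an arbitrary almost everywhere analytic family [w] on a fixed
    space.
    With the parameters of the network itself, the induction would have to pull back
    null sets of the parameter space of the first layers along a projection. *)
Lemma net_ae_analytic n0 nD (N : network n0 nD)
    (w : 'rV[R]_p -> 'rV[R]_(nparams N)) (x : 'rV[R]_n0) :
  net_piecewise_analytic N ->
  (forall i j, ae_analytic (fun t => w t i j)) ->
  forall i j, ae_analytic (fun t => net_eval (w t) x i j).
Proof.
elim: N w => [n1 l|n1 n2 N IHN l] w /=.
  move=> hl hw; apply: layer_ae_analytic => // i j; exact: ae_analytic_cst.
move=> [hN hl] hw; apply: layer_ae_analytic => //.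
- apply: (reindex_ae_analytic (B := w) (e := fun i _ => i)
    (e' := fun _ j => rshift _ j)) => // t i j; by rewrite mxE.
- apply: IHN => //.
  apply: (reindex_ae_analytic (B := w) (e := fun i _ => i)
    (e' := fun _ j => lshift _ j)) => // t i j; by rewrite mxE.
Qed.

End Networks.

Theorem corollary9 (R : realType) (n0 nD : nat) (N : @network R n0 nD)
  (hN : net_piecewise_analytic N)
  (m : nat) (hm : (0 < m)%N)
  (x : 'I_m -> 'rV[R]_n0) (y : 'I_m -> 'rV[R]_nD)
  (l : 'rV[R]_nD -> 'rV[R]_nD -> R) (hl : analytic_loss l) :
  ae_analytic (empirical_loss x y l : 'rV[R]_(nparams N) -> R).
Proof.
apply: ae_analyticM; first exact: ae_analytic_cst.
apply: ae_analytic_sum => i.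
rewrite (_ : (fun t => _) = (fun t => (fun v => l (lsubmx v) (rsubmx v))
    (row_mx (y i) (net_eval t (x i))))); last first.
  by apply/funext => t; rewrite row_mxKl row_mxKr.
apply: (@ae_analytic_comp _ _ _ (fun v => l (lsubmx v) (rsubmx v))
  (fun t => row_mx (y i) (net_eval t (x i)))) => [t|j].
  exact: hl.
have hnet : forall k j, ae_analytic (fun t : 'rV[R]_(nparams N) => net_eval t (x i) k j).
  apply: (@net_ae_analytic R _ _ _ N id (x i) hN) => k j'; rewrite (ord1 k).
  by apply: ae_analytic_everywhere => t; exact: analytic_at_coord.
have [k jk|k jk] := splitP j.
- rewrite (_ : (fun t => _) = fun=> y i 0 k); first exact: ae_analytic_cst.
  apply/funext => t; rewrite (_ : j = lshift _ k) ?row_mxEl//; exact: val_inj.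
- rewrite (_ : (fun t => _) = (fun t => net_eval t (x i) 0 k)); first exact: hnet.
  apply/funext => t; rewrite (_ : j = rshift _ k) ?row_mxEr//; exact: val_inj.
Qed.
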